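(* The flat (respectively, positive flat) model structure on $\mathrm{Sp}^\Sigma(\mathrm{s}\mathbb{Q}\text{-mod})$ and on $\mathrm{Sp}^\Sigma(\mathrm{Ch}_{\mathbb{Q}}^+)$ is the same as the stable (respectively, positive stable) model structure.
   Context: For a bicomplete closed symmetric monoidal category $(\mathscr{C},\otimes,\mathbb{1})$ and $K\in\mathscr{C}$, $\mathrm{Sp}^\Sigma(\mathscr{C},K)$ is the category of modules over $\mathrm{Sym}(K)=(\mathbb{1},K,K^{\otimes2},\dots)$ in symmetric sequences $\mathscr{C}^\Sigma$ (Day convolution); an object is a sequence of $\Sigma_n$-objects $X_n$ with $\Sigma_n$-equivariant maps $K\otimes X_n\to X_{n+1}$ whose iterates $K^{\otimes m}\otimes X_n\to X_{n+m}$ are $\Sigma_m\times\Sigma_n$-equivariant. $\mathrm{Sp}^\Sigma(\mathrm{s}\mathbb{Q}\text{-mod})=\mathrm{Sp}^\Sigma(\mathrm{s}\mathbb{Q}\text{-mod},\widetilde{\mathbb{Q}}S^1)$, with $\mathrm{s}\mathbb{Q}\text{-mod}$ the simplicial $\mathbb{Q}$-modules (weak equivalences and fibrations those of underlying simplicial sets) and $\widetilde{\mathbb{Q}}$ the levelwise free $\mathbb{Q}$-module on non-basepoint simplices. $\mathrm{Sp}^\Sigma(\mathrm{Ch}_{\mathbb{Q}}^+)=\mathrm{Sp}^\Sigma(\mathrm{Ch}_{\mathbb{Q}}^+,\mathbb{Q}[1])$, with $\mathrm{Ch}_{\mathbb{Q}}^+$ the non-negatively graded rational chain complexes (projective model structure)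 and $\mathbb{Q}[1]$ equal to $\mathbb{Q}$ in degree 1. For a finite group $G$, a map $f$ in the category $G\mathscr{C}$ of $G$-objects is a naive weak equivalence (naive fibration) if its underlying map is a weak equivalence (fibration) in $\mathscr{C}$; a genuine cofibration if it has the left lifting property against all maps $p$ with $p^H$ an acyclic fibration for every $H\le G$; a blended fibration if it has the right lifting property against maps that are both naive weak equivalences and genuine cofibrations. The stable model structure (Hovey) is the left Bousfield localization of the level model structure (levelwise weak equivalences and levelwise fibrations) at the maps $F_{n+1}(K\otimes C)\to F_nC$, $n\ge0$, $C$ a domain or codomain of a generating cofibration of $\mathscr{C}$, where $F_n$ is left adjoint to evaluation at level $n$. Its weak equivalences are the stable equivalences; its cofibrations are the maps with the left lifting property against the maps that are naive weak equivalences and naive fibrations at each level $n\ge 0$. All four model structures have the stable equivalences as weak equivalences. The cofibrations of the positive stable model structure are the maps with the left lifting property against maps that are naive weak equivalences and naive fibrations at each level $n>0$. The cofibrations of the flat (positive flat) model structure are the maps with the left lifting property against maps that are both naive weak equivalences and blended fibrations (of $\Sigma_n$-objects) at each level $n\ge0$ ($n>0$). *)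

(* Defs.v *)
From HB Require Import structures.
From mathcomp Require Import all_boot all_order all_fingroup all_algebra.
From mathcomp Require Import generic_quotient boolp zify.

Set Implicit Arguments.
Unset Strict Implicit.
Unset Printing Implicit Defensive.

Import GRing.Theory.

(* Composition is diagrammatic: f >> g is "f, then g". *)
Record category := Category {
  ob :> Type;
  hom : ob -> ob -> Type;
  idm : forall a, hom a a;
  comp : forall a b c, hom a b -> hom b c -> hom a c;
  comp1m : forall a b (f : hom a b), comp (idm a) f = f;
  compm1 : forall a b (f : hom a b), comp f (idm b) = f;
  compA : forall a b c d (f : hom a b) (g : hom b c) (h : hom c d),
    comp f (comp g h) = comp (comp f g) h }.

Arguments idm {c0} a.

Declare Scope cat_scope.
Delimit Scope cat_scope with cat.
Local Open Scope cat_scope.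

Reserved Notation "f >> g" (at level 50, left associativity).
Notation "f >> g" := (comp f g) : cat_scope.
Notation "a ~> b" := (hom a b) (at level 99, b at level 200) : cat_scope.

Definition terminal (C : category) (t : C) :=
  forall a : C, exists f : a ~> t, forall g : a ~> t, g = f.

Definition mclass (C : category) := forall a b : C, (a ~> b) -> Prop.

Definition mcap (C : category) (P Q : mclass C) : mclass C :=
  fun a b f => P a b f /\ Q a b f.

Definition has_lift (C : category) (a b c d : C) (f : a ~> b) (g : c ~> d) :=
  forall (u : a ~> c) (v : b ~> d), u >> g = f >> v ->
  exists h : b ~> c, f >> h = u /\ h >> g = v.

Definition llp (C : category) (P : mclass C) : mclass C :=
  fun a b f => forall (c d : C) (g : c ~> d), P c d g -> has_lift f g.

Definition rlp (C : category) (P : mclass C) : mclass C :=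
  fun c d g => forall (a b : C) (f : a ~> b), P a b f -> has_lift f g.

Record symmoncat := SymMonCat {
  smcat :> category;
  tunit : smcat;
  tens : smcat -> smcat -> smcat;
  tensm : forall a a' b b' : smcat,
    (a ~> a') -> (b ~> b') -> (tens a b ~> tens a' b');
  assoc : forall a b c, tens (tens a b) c ~> tens a (tens b c);
  associ : forall a b c, tens a (tens b c) ~> tens (tens a b) c;
  lunit : forall a, tens tunit a ~> a;
  luniti : forall a, a ~> tens tunit a;
  runit : forall a, tens a tunit ~> a;
  runiti : forall a, a ~> tens a tunit;
  braid : forall a b, tens a b ~> tens b a;
  tensm1 : forall a b, tensm (idm a) (idm b) = idm (tens a b);
  tensmM : forall (a a' a'' b b' b'' : smcat) (f : a ~> a') (f' : a' ~> a'')
    (g : b ~> b') (g' : b' ~> b''),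
    tensm (f >> f') (g >> g') = tensm f g >> tensm f' g';
  assoc_nat : forall (a a' b b' c c' : smcat)
    (f : a ~> a') (g : b ~> b') (h : c ~> c'),
    tensm (tensm f g) h >> assoc a' b' c' =
    assoc a b c >> tensm f (tensm g h);
  assocK : forall a b c, assoc a b c >> associ a b c = idm _;
  associK : forall a b c, associ a b c >> assoc a b c = idm _;
  lunit_nat : forall (a a' : smcat) (f : a ~> a'),
    tensm (idm tunit) f >> lunit a' = lunit a >> f;
  lunitK : forall a, lunit a >> luniti a = idm _;
  lunitiK : forall a, luniti a >> lunit a = idm _;
  runit_nat : forall (a a' : smcat) (f : a ~> a'),
    tensm f (idm tunit) >> runit a' = runit a >> f;
  runitK : forall a, runit a >> runiti a = idm _;
  runitiK : forall a, runiti a >> runit a = idm _;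
  braid_nat : forall (a a' b b' : smcat) (f : a ~> a') (g : b ~> b'),
    tensm f g >> braid a' b' = braid a b >> tensm g f;
  braidK : forall a b, braid a b >> braid b a = idm _;
  pentagon : forall a b c d,
    tensm (assoc a b c) (idm d) >> assoc a (tens b c) d >>
      tensm (idm a) (assoc b c d) =
    assoc (tens a b) c d >> assoc a b (tens c d);
  triangle : forall a b,
    assoc a tunit b >> tensm (idm a) (lunit b) = tensm (runit a) (idm b);
  hexagon : forall a b c,
    assoc a b c >> braid a (tens b c) >> assoc b c a =
    tensm (braid a b) (idm c) >> assoc b a c >> tensm (idm b) (braid a c) }.

Arguments tunit {s}.
Arguments tensm {s a a' b b'}.
Arguments assoc {s}.
Arguments associ {s}.
Arguments lunit {s}.
Arguments luniti {s}.
Arguments runit {s}.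
Arguments runiti {s}.
Arguments braid {s}.

Definition monotone m n (f : {ffun 'I_m.+1 -> 'I_n.+1}) :=
  [forall i : 'I_m.+1, forall j : 'I_m.+1, (i <= j)%N ==> (f i <= f j)%N].

Definition mono m n := {f : {ffun 'I_m.+1 -> 'I_n.+1} | monotone f}.

Definition mono_fun m n (f : mono m n) : 'I_m.+1 -> 'I_n.+1 := sval f.
Coercion mono_fun : mono >-> Funclass.

Lemma monoP m n (f : mono m n) (i j : 'I_m.+1) : (i <= j)%N -> (f i <= f j)%N.
Proof.
by move: (svalP f) => /forallP/(_ i)/forallP/(_ j)/implyP; apply.
Qed.

Lemma mono_ext m n (f g : mono m n) : f =1 g -> f = g.
Proof. by move=> fg; apply/val_inj/ffunP. Qed.

Lemma mono_id_subproof n : monotone [ffun i : 'I_n.+1 => i].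
Proof. by do 2!apply/forallP => ?; apply/implyP; rewrite !ffunE. Qed.
Definition mono_id n : mono n n := Sub _ (mono_id_subproof n).

Lemma mono_comp_subproof m n p (f : mono m n) (g : mono n p) :
  monotone [ffun i => g (f i)].
Proof.
apply/forallP => i; apply/forallP => j; apply/implyP => ij.
by rewrite !ffunE; do 2!apply: monoP.
Qed.
Definition mono_comp m n p (f : mono m n) (g : mono n p) : mono m p :=
  Sub _ (mono_comp_subproof f g).

Lemma mono_idE n i : mono_id n i = i.
Proof. by rewrite /mono_fun /= ffunE. Qed.

Lemma mono_compE m n p (f : mono m n) (g : mono n p) i :
  mono_comp f g i = g (f i).
Proof. by rewrite {1}/mono_fun /= ffunE. Qed.

Lemma mono_comp1m m n (f : mono m n) : mono_comp (mono_id m) f = f.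
Proof. by apply: mono_ext => i; rewrite mono_compE mono_idE. Qed.

Lemma mono_compm1 m n (f : mono m n) : mono_comp f (mono_id n) = f.
Proof. by apply: mono_ext => i; rewrite mono_compE mono_idE. Qed.

Lemma mono_compA m n p q (f : mono m n) (g : mono n p) (h : mono p q) :
  mono_comp f (mono_comp g h) = mono_comp (mono_comp f g) h.
Proof. by apply: mono_ext => i; rewrite !mono_compE. Qed.

Record simplicial (C : category) := Simplicial {
  sob :> nat -> C;
  srestr : forall m n, mono m n -> sob n ~> sob m;
  srestr1 : forall n, srestr (mono_id n) = idm (sob n);
  srestrM : forall m n p (f : mono m n) (g : mono n p),
    srestr (mono_comp f g) = srestr g >> srestr f }.
Arguments srestr {C} s {m n}.

Record simplicial_map (C : category) (X Y : simplicial C) := SimplicialMap {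
  smap :> forall n, X n ~> Y n;
  smap_nat : forall m n (f : mono m n),
    srestr X f >> smap m = smap n >> srestr Y f }.

Record cosimplicial (C : category) := Cosimplicial {
  cob :> nat -> C;
  cmap : forall m n, mono m n -> cob m ~> cob n;
  cmap1 : forall n, cmap (mono_id n) = idm (cob n);
  cmapM : forall m n p (f : mono m n) (g : mono n p),
    cmap (mono_comp f g) = cmap f >> cmap g }.
Arguments cmap {C} c {m n}.

Record cosimplicial_map (C : category) (X Y : cosimplicial C) :=
  CosimplicialMap {
  csmap :> forall n, X n ~> Y n;
  csmap_nat : forall m n (f : mono m n),
    cmap X f >> csmap n = csmap m >> cmap Y f }.

Section SimplicialCategory.
Variable C : category.

Lemma smap_ext (X Y : simplicial C) (f g : simplicial_map X Y) :
  (forall n, f n = g n) -> f = g.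
Proof.
case: f g => [f ef] [g eg] /= fgE.
have fg : f = g := functional_extensionality_dep fgE; clear fgE.
by subst g; congr SimplicialMap; apply: Prop_irrelevance.
Qed.

Lemma scomp_subproof (X Y Z : simplicial C) (f : simplicial_map X Y)
    (g : simplicial_map Y Z) m n (h : mono m n) :
  srestr X h >> (f m >> g m) = f n >> g n >> srestr Z h.
Proof. by rewrite compA smap_nat -!compA smap_nat. Qed.

Lemma sid_subproof (X : simplicial C) m n (h : mono m n) :
  srestr X h >> idm (X m) = idm (X n) >> srestr X h.
Proof. by rewrite comp1m compm1. Qed.

Definition simp_cat : category.
Proof.
refine (@Category (simplicial C) (@simplicial_map C)
  (fun X => SimplicialMap (@sid_subproof X))
  (fun X Y Z f g => SimplicialMap (scomp_subproof f g)) _ _ _).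
- by move=> X Y f; apply: smap_ext => n /=; rewrite comp1m.
- by move=> X Y f; apply: smap_ext => n /=; rewrite compm1.
- by move=> X Y Z T f g h; apply: smap_ext => n /=; rewrite compA.
Defined.

End SimplicialCategory.

Section SimplicialSymMon.
Variable C : symmoncat.

Lemma stens_subproof1 (X Y : simplicial C) n :
  tensm (srestr X (mono_id n)) (srestr Y (mono_id n)) = idm (tens (X n) (Y n)).
Proof. by rewrite !srestr1 tensm1. Qed.

Lemma stens_subproofM (X Y : simplicial C) m n p (f : mono m n) (g : mono n p) :
  tensm (srestr X (mono_comp f g)) (srestr Y (mono_comp f g)) =
  tensm (srestr X g) (srestr Y g) >> tensm (srestr X f) (srestr Y f).
Proof. by rewrite !srestrM tensmM. Qed.

Definition stens (X Y : simplicial C) : simplicial C :=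
  Simplicial (@stens_subproof1 X Y) (@stens_subproofM X Y).

Lemma stunit_subproof (m n p : nat) (f : mono m n) (g : mono n p) :
  idm (@tunit C) = idm tunit >> idm tunit.
Proof. by rewrite comp1m. Qed.

Definition stunit : simplicial C :=
  @Simplicial C (fun=> tunit) (fun _ _ _ => idm tunit) (fun=> erefl)
    stunit_subproof.

Lemma stensm_subproof (X X' Y Y' : simplicial C) (f : simplicial_map X X')
    (g : simplicial_map Y Y') m n (h : mono m n) :
  srestr (stens X Y) h >> tensm (f m) (g m) =
  tensm (f n) (g n) >> srestr (stens X' Y') h.
Proof. by rewrite /= -!tensmM !smap_nat. Qed.

Lemma sassoc_subproof (X Y Z : simplicial C) m n (h : mono m n) :
  srestr (stens (stens X Y) Z) h >> assoc (X m) (Y m) (Z m) =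
  assoc (X n) (Y n) (Z n) >> srestr (stens X (stens Y Z)) h.
Proof. by rewrite /= assoc_nat. Qed.

Lemma sassoci_subproof (X Y Z : simplicial C) m n (h : mono m n) :
  srestr (stens X (stens Y Z)) h >> associ (X m) (Y m) (Z m) =
  associ (X n) (Y n) (Z n) >> srestr (stens (stens X Y) Z) h.
Proof.
rewrite -[LHS]comp1m -associK -compA; congr (_ >> _).
by rewrite compA -sassoc_subproof -compA assocK compm1.
Qed.

Lemma slunit_subproof (X : simplicial C) m n (h : mono m n) :
  srestr (stens stunit X) h >> lunit (X m) = lunit (X n) >> srestr X h.
Proof. exact: lunit_nat. Qed.

Lemma sluniti_subproof (X : simplicial C) m n (h : mono m n) :
  srestr X h >> luniti (X m) = luniti (X n) >> srestr (stens stunit X) h.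
Proof.
rewrite -[LHS]comp1m -lunitiK -compA; congr (_ >> _).
by rewrite compA -slunit_subproof -compA lunitK compm1.
Qed.

Lemma srunit_subproof (X : simplicial C) m n (h : mono m n) :
  srestr (stens X stunit) h >> runit (X m) = runit (X n) >> srestr X h.
Proof. exact: runit_nat. Qed.

Lemma sruniti_subproof (X : simplicial C) m n (h : mono m n) :
  srestr X h >> runiti (X m) = runiti (X n) >> srestr (stens X stunit) h.
Proof.
rewrite -[LHS]comp1m -runitiK -compA; congr (_ >> _).
by rewrite compA -srunit_subproof -compA runitK compm1.
Qed.

Lemma sbraid_subproof (X Y : simplicial C) m n (h : mono m n) :
  srestr (stens X Y) h >> braid (X m) (Y m) =
  braid (X n) (Y n) >> srestr (stens Y X) h.
Proof. exact: braid_nat. Qed.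

Definition simp_symmon : symmoncat.
Proof.
refine (@SymMonCat (simp_cat C) stunit stens
  (fun X X' Y Y' f g => @SimplicialMap C (stens X Y)
    (stens X' Y') _ (@stensm_subproof X X' Y Y' f g))
  (fun X Y Z => @SimplicialMap C (stens (stens X Y) Z)
    (stens X (stens Y Z)) _ (@sassoc_subproof X Y Z))
  (fun X Y Z => @SimplicialMap C (stens X (stens Y Z))
    (stens (stens X Y) Z) _ (@sassoci_subproof X Y Z))
  (fun X => @SimplicialMap C (stens stunit X)
    X _ (@slunit_subproof X))
  (fun X => @SimplicialMap C X
    (stens stunit X) _ (@sluniti_subproof X))
  (fun X => @SimplicialMap C (stens X stunit)
    X _ (@srunit_subproof X))
  (fun X => @SimplicialMap C X
    (stens X stunit) _ (@sruniti_subproof X))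
  (fun X Y => @SimplicialMap C (stens X Y)
    (stens Y X) _ (@sbraid_subproof X Y))
  _ _ _ _ _ _ _ _ _ _ _ _ _ _ _ _); intros; apply: smap_ext => n /=.
- exact: tensm1.
- exact: tensmM.
- exact: assoc_nat.
- exact: assocK.
- exact: associK.
- exact: lunit_nat.
- exact: lunitK.
- exact: lunitiK.
- exact: runit_nat.
- exact: runitK.
- exact: runitiK.
- exact: braid_nat.
- exact: braidK.
- exact: pentagon.
- exact: triangle.
- exact: hexagon.
Defined.

End SimplicialSymMon.

Definition type_cat : category :=
  @Category Type (fun A B => A -> B) (fun A => id)
    (fun A B C f g x => g (f x)) (fun _ _ _ => erefl) (fun _ _ _ => erefl)
    (fun _ _ _ _ _ _ _ => erefl).

Definition sset : category := simp_cat type_cat.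

Definition std_simplex (n : nat) : sset :=
  @Simplicial type_cat (fun m => mono m n) (fun m p f g => mono_comp f g)
    (fun m => funext (@mono_comp1m m n))
    (fun m p q f g => funext (fun h => esym (mono_compA f g h))).

Section SubSset.
Variables (X : sset) (P : forall m, X m -> Prop).
Hypothesis P_closed :
  forall m n (f : mono m n) (x : X n), P x -> P (srestr X f x).

Definition sub_restr m n (f : mono m n) (x : {x : X n | P x}) :
  {x : X m | P x} := exist _ (srestr X f (sval x)) (P_closed f (svalP x)).

Lemma sub_sset_ext n (x y : {x : X n | P x}) : sval x = sval y -> x = y.
Proof.
case: x y => [x px] [y py] /= e; subst y.
by congr exist; apply: Prop_irrelevance.
Qed.

Lemma sub_restr1 n : @sub_restr n n (mono_id n) = id.
Proof.
by apply: funext => x; apply: sub_sset_ext => /=; rewrite srestr1.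
Qed.

Lemma sub_restrM m n p (f : mono m n) (g : mono n p) :
  sub_restr (mono_comp f g) = (fun x => sub_restr f (sub_restr g x)).
Proof.
by apply: funext => x; apply: sub_sset_ext => /=; rewrite srestrM.
Qed.

Definition sub_sset : sset :=
  @Simplicial type_cat (fun m => {x : X m | P x}) sub_restr sub_restr1
    sub_restrM.

Definition sub_incl : sub_sset ~> X :=
  @SimplicialMap type_cat sub_sset X (fun m => sval) (fun _ _ _ => erefl).

End SubSset.

Definition bdry_pred n m (f : std_simplex n m) : Prop :=
  exists j, forall i, (f : mono m n) i != j.

Definition horn_pred n (k : 'I_n.+1) m (f : std_simplex n m) : Prop :=
  exists2 j, j != k & forall i, (f : mono m n) i != j.

Lemma bdry_closed n m p (f : mono m p) (x : std_simplex n p) :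
  bdry_pred x -> bdry_pred (srestr (std_simplex n) f x).
Proof. by case=> j jP; exists j => i; rewrite mono_compE. Qed.

Lemma horn_closed n (k : 'I_n.+1) m p (f : mono m p) (x : std_simplex n p) :
  horn_pred k x -> horn_pred k (srestr (std_simplex n) f x).
Proof. by case=> j jk jP; exists j => // i; rewrite mono_compE. Qed.

Definition bdry_incl n : sub_sset (@bdry_closed n) ~> std_simplex n :=
  sub_incl (@bdry_closed n).

Definition horn_incl n (k : 'I_n.+1) :
  sub_sset (@horn_closed n k) ~> std_simplex n := sub_incl (@horn_closed n k).

Inductive horn_inclusion : mclass sset :=
  HornInclusion n (k : 'I_n.+2) : horn_inclusion (horn_incl k).

Definition kan_fibration : mclass sset := rlp horn_inclusion.

Definition kan_complex (Z : sset) :=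
  forall (t : sset) (f : Z ~> t), terminal t -> kan_fibration f.

Definition sprod (X Y : sset) : sset.
Proof.
refine (@Simplicial type_cat (fun m => X m * Y m)%type
  (fun m n f x => (srestr X f x.1, srestr Y f x.2)) _ _).
- by move=> n; apply: funext => -[x y]; rewrite !srestr1.
- by move=> m n p f g; apply: funext => -[x y]; rewrite !srestrM.
Defined.

Lemma const_mono_subproof m (j : 'I_2) : monotone [ffun _ : 'I_m.+1 => j].
Proof. by do 2!apply/forallP => ?; rewrite !ffunE leqnn implybT. Qed.

Definition const_mono m (j : 'I_2) : std_simplex 1 m :=
  (Sub _ (const_mono_subproof m j) : mono m 1).

Definition elem_homotopic (X Z : sset) (f g : X ~> Z) :=
  exists h : sprod X (std_simplex 1) ~> Z,
    forall m (x : X m), h m (x, const_mono m 0%R) = f m x /\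
                        h m (x, const_mono m 1%R) = g m x.

(* Two maps are homotopic when they lie in the same connected component of the
   mapping space, whether or not Z is a Kan complex. *)
Inductive homotopic (X Z : sset) : (X ~> Z) -> (X ~> Z) -> Prop :=
| htp_elem f g : elem_homotopic f g -> homotopic f g
| htp_refl f : homotopic f f
| htp_sym f g : homotopic f g -> homotopic g f
| htp_trans f g h : homotopic f g -> homotopic g h -> homotopic f h.

(* Weak homotopy equivalences: precomposition induces a bijection
   pi_0 Map(Y, Z) -> pi_0 Map(X, Z) for every Kan complex Z. *)
Definition sset_weq : mclass sset := fun X Y f =>
  forall Z, kan_complex Z ->
    (forall u : X ~> Z, exists v : Y ~> Z, homotopic (f >> v) u) /\
    (forall v w : Y ~> Z, homotopic (f >> v) (f >> w) -> homotopic v w).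

(* A model structure is recorded as its three classes of maps; being a model
   structure is a property of these data. *)
Record model_data (C : category) := ModelData {
  weq : mclass C;
  fib : mclass C;
  cof : mclass C }.

Definition acyclic_fib (C : category) (M : model_data C) :=
  mcap (weq M) (fib M).

Definition fibrant (C : category) (M : model_data C) (W : C) :=
  forall (t : C) (f : W ~> t), terminal t -> fib M f.

Section HomotopyFunctionComplex.
Variables (C : category) (M : model_data C).

(* The latching object of A at n is the colimit of the A k over the injections
   [k] -> [n] with k < n. *)
Record latching_cocone (A : cosimplicial C) (n : nat) (L : C) := {
  leg :> forall k (f : mono k n), (k < n)%N -> injective f -> A k ~> L;
  leg_nat : forall j k (g : mono j k) (f : mono k n)
    (kn : (k < n)%N) (finj : injective f) (jn : (j < n)%N)
    (gfinj : injective (mono_comp g f)),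
    injective g -> leg jn gfinj = cmap A g >> leg kn finj }.

Definition latching_object A n L (l : latching_cocone A n L) :=
  forall L' (l' : latching_cocone A n L'),
  exists! h : L ~> L', forall k (f : mono k n) kn (finj : injective f),
    l k f kn finj >> h = l' k f kn finj.

Definition reedy_cofibrant (A : cosimplicial C) :=
  forall n L (l : latching_cocone A n L) (h : L ~> A n),
    latching_object l ->
    (forall k (f : mono k n) kn (finj : injective f),
      l k f kn finj >> h = cmap A f) ->
    cof M h.

(* A cosimplicial resolution of a: a Reedy cofibrant cosimplicial object with a
   levelwise weak equivalence e to the constant cosimplicial object at a. *)
Definition cosimplicial_resolution (a : C) (A : cosimplicial C)
    (e : forall n, A n ~> a) :=
  [/\ forall m n (f : mono m n), cmap A f >> e n = e m,
      forall n, weq M (e n) & reedy_cofibrant A].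

Definition map_space (A : cosimplicial C) (W : C) : sset.
Proof.
refine (@Simplicial type_cat (fun n => A n ~> W)
  (fun m n f u => cmap A f >> u) _ _).
- by move=> n; apply: funext => u; rewrite cmap1 comp1m.
- by move=> m n p f g; apply: funext => u; rewrite cmapM -compA.
Defined.

Definition map_space_pre (A B : cosimplicial C) (f : cosimplicial_map A B)
    (W : C) : map_space B W ~> map_space A W.
Proof.
refine (@SimplicialMap type_cat (map_space B W) (map_space A W)
  (fun n u => f n >> u) _).
by move=> m n h; apply: funext => u; rewrite /= compA -csmap_nat -compA.
Defined.

(* "map(b, W) -> map(a, W) is a weak equivalence" for a fibrant W. *)
Definition map_space_weq (a b : C) (f : a ~> b) (W : C) :=
  exists (A B : cosimplicial C) (d : forall n, A n ~> a)
    (e : forall n, B n ~> b) (g : cosimplicial_map A B),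
  [/\ cosimplicial_resolution d, cosimplicial_resolution e,
      forall n, g n >> e n = d n >> f & sset_weq (map_space_pre g W)].

Definition local_object (S : mclass C) (W : C) :=
  fibrant M W /\ forall (a b : C) (f : a ~> b), S a b f -> map_space_weq f W.

Definition local_weq (S : mclass C) : mclass C := fun a b f =>
  forall W, local_object S W -> map_space_weq f W.

Definition bousfield (S : mclass C) : model_data C :=
  {| weq := local_weq S;
     fib := rlp (mcap (cof M) (local_weq S));
     cof := cof M |}.

End HomotopyFunctionComplex.

Section GObjects.
Variables (gT : finGroupType) (C : category).

(* MathComp composes permutations diagrammatically, (s * t) i = t (s i), as we
   do morphisms, so for gT = 'S_n this is the usual notion of left action. *)
Record gobj := GObj {
  gcar :> C;
  act : gT -> gcar ~> gcar;
  act1 : act 1%g = idm gcar;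
  actM : forall g h, act (g * h)%g = act g >> act h }.

Record ghom (X Y : gobj) := GHom {
  gfun :> gcar X ~> gcar Y;
  ghomP : forall g, act X g >> gfun = gfun >> act Y g }.

Lemma ghom_ext (X Y : gobj) (f g : ghom X Y) : gfun f = gfun g -> f = g.
Proof.
case: f g => [f ef] [g eg] /= fg.
by subst g; congr GHom; apply: Prop_irrelevance.
Qed.

Lemma gid_subproof (X : gobj) g : act X g >> idm _ = idm _ >> act X g.
Proof. by rewrite comp1m compm1. Qed.

Lemma gcomp_subproof (X Y Z : gobj) (u : ghom X Y) (v : ghom Y Z) g :
  act X g >> (u >> v) = (u >> v) >> act Z g.
Proof. by rewrite compA ghomP -!compA ghomP. Qed.

Definition gcat : category.
Proof.
refine (@Category gobj ghom (fun X => GHom (@gid_subproof X))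
  (fun X Y Z u v => GHom (gcomp_subproof u v)) _ _ _).
- by move=> X Y f; apply: ghom_ext => /=; rewrite comp1m.
- by move=> X Y f; apply: ghom_ext => /=; rewrite compm1.
- by move=> X Y Z T f g h; apply: ghom_ext => /=; rewrite compA.
Defined.

(* i : E -> X exhibits E as the fixed points X^H. *)
Definition fixed_points (X : gobj) (H : {group gT}) (E : C) (i : E ~> X) :=
  (forall h, h \in H -> i >> act X h = i) /\
  forall (T : C) (f : T ~> X), (forall h, h \in H -> f >> act X h = f) ->
    exists! g : T ~> E, g >> i = f.

Variable M : model_data C.

Definition naive_weq : mclass gcat := fun X Y f => weq M (gfun f).

Definition naive_fib : mclass gcat := fun X Y f => fib M (gfun f).

Definition genuine_acyclic_fib : mclass gcat := fun X Y p =>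
  forall (H : {group gT}) (E F : C) (i : E ~> gcar X) (j : F ~> gcar Y)
    (pH : E ~> F),
  fixed_points H i -> fixed_points H j -> pH >> j = i >> gfun p ->
  acyclic_fib M pH.

Definition genuine_cof : mclass gcat := llp genuine_acyclic_fib.

Definition blended_fib : mclass gcat := rlp (mcap naive_weq genuine_cof).

End GObjects.

Lemma perm_tail_subproof n (s : 'S_n.+1) :
  injective (fun i : 'I_n => odflt i (unlift (s ord0) (s (lift ord0 i)))).
Proof.
move=> i j; have E k : s ord0 != s (lift ord0 k).
  by rewrite (inj_eq perm_inj) neq_lift.
have [i' ei ->] := unlift_some (E i); have [j' ej ->] := unlift_some (E j).
by move=> /= ij; apply: (@lift_inj _ ord0); apply: (@perm_inj _ s); rewrite ei ej ij.
Qed.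

(* The permutation of 'I_n obtained from s by deleting 0 and s 0. *)
Definition perm_tail n (s : 'S_n.+1) : 'S_n := perm (@perm_tail_subproof n s).

Lemma perm_block_subproof m n (s : 'S_m) (t : 'S_n) :
  injective (fun i : 'I_(m + n) =>
    match split i with inl j => lshift n (s j) | inr k => rshift m (t k) end).
Proof.
apply: (can_inj (g := fun i : 'I_(m + n) =>
  match split i with
  | inl j => lshift n (s^-1%g j) | inr k => rshift m (t^-1%g k) end)) => i.
case: (split_ordP i) => k ->.
  by rewrite -[lshift n (s k)]/(unsplit (inl (s k))) unsplitK permK.
by rewrite -[rshift m (t k)]/(unsplit (inr (t k))) unsplitK permK.
Qed.

(* s acts on the first m points and t on the last n. *)
Definition perm_block m n (s : 'S_m) (t : 'S_n) : 'S_(m + n) :=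
  perm (@perm_block_subproof m n s t).

Section Spectra.
Variables (C : symmoncat) (K : C).

Fixpoint tpow (m : nat) : C := if m is m'.+1 then tens K (tpow m') else tunit.

(* Moves the first tensor factor of K^(m+1) to position j. *)
Fixpoint tinsert (m j : nat) {struct m} : tens K (tpow m) ~> tpow m.+1 :=
  match m, j return tens K (tpow m) ~> tpow m.+1 with
  | m'.+1, j'.+1 =>
      associ K K (tpow m') >> tensm (braid K K) (idm (tpow m')) >>
      assoc K K (tpow m') >> tensm (idm K) (tinsert m' j')
  | _, _ => idm _
  end.

(* The action of s on K^m: the factor at position i goes to position s i. *)
Fixpoint tpow_act (m : nat) : 'S_m -> tpow m ~> tpow m :=
  match m return 'S_m -> tpow m ~> tpow m with
  | 0 => fun=> idm tunit
  | m'.+1 => fun s =>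
      tensm (idm K) (tpow_act (perm_tail s)) >> tinsert m' (s ord0)
  end.

Fixpoint iter_struct (X : nat -> C) (sigma : forall n, tens K (X n) ~> X n.+1)
    (m n : nat) : tens (tpow m) (X n) ~> X (m + n)%N :=
  match m return tens (tpow m) (X n) ~> X (m + n)%N with
  | 0 => lunit (X n)
  | m'.+1 => assoc K (tpow m') (X n) >>
             tensm (idm K) (iter_struct sigma m' n) >> sigma (m' + n)%N
  end.

Record spectrum := Spectrum {
  level :> forall n, gobj 'S_n C;
  sigma : forall n, tens K (level n) ~> level n.+1;
  sigmaP : forall n (t : 'S_n),
    tensm (idm K) (act (level n) t) >> sigma n =
    sigma n >> act (level n.+1) (perm_block (1%g : 'S_1) t);
  iter_sigmaP : forall m n (s : 'S_m) (t : 'S_n),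
    tensm (tpow_act s) (act (level n) t) >> iter_struct sigma m n =
    iter_struct sigma m n >> act (level (m + n)) (perm_block s t) }.

Record spectrum_map (X Y : spectrum) := SpectrumMap {
  spmap :> forall n, ghom (X n) (Y n);
  spmapP : forall n,
    sigma X n >> spmap n.+1 = tensm (idm K) (gfun (spmap n)) >> sigma Y n }.

Lemma spmap_ext (X Y : spectrum) (f g : spectrum_map X Y) :
  (forall n, f n = g n) -> f = g.
Proof.
case: f g => [f ef] [g eg] /= fgE.
have fg : f = g := functional_extensionality_dep fgE; clear fgE.
by subst g; congr SpectrumMap; apply: Prop_irrelevance.
Qed.

Lemma spid_subproof (X : spectrum) n :
  sigma X n >> idm _ = tensm (idm K) (idm _) >> sigma X n.
Proof. by rewrite tensm1 comp1m compm1. Qed.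

Lemma spcomp_subproof (X Y Z : spectrum) (f : spectrum_map X Y)
    (g : spectrum_map Y Z) n :
  sigma X n >> (f n.+1 >> g n.+1) =
  tensm (idm K) (f n >> g n) >> sigma Z n.
Proof.
by rewrite compA spmapP -compA spmapP compA -tensmM comp1m.
Qed.

Definition sp_cat : category.
Proof.
refine (@Category spectrum spectrum_map
  (fun X => @SpectrumMap X X (fun n => idm (X n : gcat 'S_n C))
    (@spid_subproof X))
  (fun X Y Z f g => @SpectrumMap X Z
    (fun n => (f n : (X n : gcat 'S_n C) ~> Y n) >> g n)
    (spcomp_subproof f g)) _ _ _).
- by move=> X Y f; apply: spmap_ext => n; apply: (@comp1m (gcat _ _)).
- by move=> X Y f; apply: spmap_ext => n; apply: (@compm1 (gcat _ _)).
- by move=> X Y Z T f g h; apply: spmap_ext => n; apply: (@compA (gcat _ _)).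
Defined.

(* u exhibits F as the free spectrum F_n a, i.e. the value at a of the left
   adjoint of evaluation at level n. *)
Definition free_spectrum (n : nat) (a : C) (F : sp_cat)
    (u : a ~> level F n) :=
  forall (X : sp_cat) (f : a ~> level X n),
    exists! g : F ~> X, u >> gfun (spmap g n) = f.

Variables (M : model_data C) (gencof : mclass C).

Definition level_weq : mclass sp_cat := fun X Y f =>
  forall n, naive_weq M (spmap f n).

Definition level_fib : mclass sp_cat := fun X Y f =>
  forall n, naive_fib M (spmap f n).

Definition level_model : model_data sp_cat :=
  {| weq := level_weq;
     fib := level_fib;
     cof := llp (mcap level_weq level_fib) |}.

Definition gencof_object (a : C) :=
  exists (b c : C) (i : b ~> c), gencof i /\ (a = b \/ a = c).

(* The maps F_(n+1) (K (x) a) -> F_n a adjoint to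
   K (x) a -> K (x) (F_n a)_n -> (F_n a)_(n+1). *)
Definition stabilizing_map : mclass sp_cat := fun F' F f =>
  exists n (a : C) (u : a ~> level F n) (v : tens K a ~> level F' n.+1),
  [/\ gencof_object a, free_spectrum u, free_spectrum v &
      v >> gfun (spmap f n.+1) = tensm (idm K) u >> sigma F n].

Definition stable_model : model_data sp_cat :=
  bousfield level_model stabilizing_map.

Definition stable_equiv : mclass sp_cat := weq stable_model.

Definition model_of_cof (c : mclass sp_cat) : model_data sp_cat :=
  {| weq := stable_equiv;
     fib := rlp (mcap c stable_equiv);
     cof := c |}.

Definition positive_stable_model : model_data sp_cat :=
  model_of_cof (llp (fun (X Y : sp_cat) f => forall n, (0 < n)%N ->
    naive_weq M (spmap f n) /\ naive_fib M (spmap f n))).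

Definition flat_model : model_data sp_cat :=
  model_of_cof (llp (fun (X Y : sp_cat) f => forall n,
    naive_weq M (spmap f n) /\ blended_fib M (spmap f n))).

Definition positive_flat_model : model_data sp_cat :=
  model_of_cof (llp (fun (X Y : sp_cat) f => forall n, (0 < n)%N ->
    naive_weq M (spmap f n) /\ blended_fib M (spmap f n))).

End Spectra.

Local Open Scope ring_scope.
Local Open Scope cat_scope.

(* The Q-module with generators T and relations rel: formal linear combinations
   modulo the submodule spanned by rel, two of which agree iff they have the same
   value under every map from T to a Q-module that respects rel. *)
Section Presented.
Variables (T : Type) (rel : seq (rat * T) -> Prop).

Definition lincomb (V : lmodType rat) (f : T -> V) (s : seq (rat * T)) : V :=
  \sum_(p <- s) p.1 *: f p.2.

Definition respects (V : lmodType rat) (f : T -> V) :=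
  forall r, rel r -> lincomb f r = 0.

Definition formal_sum := seq (rat * T).
HB.instance Definition _ := gen_eqMixin formal_sum.
HB.instance Definition _ := gen_choiceMixin formal_sum.

Definition congruent (s s' : formal_sum) :=
  forall (V : lmodType rat) (f : T -> V), respects f ->
    lincomb f s = lincomb f s'.

Definition congruentb (s s' : formal_sum) := `[< congruent s s' >].

Lemma congruentb_refl : reflexive congruentb.
Proof. by move=> s; apply/asboolP. Qed.

Lemma congruentb_sym : symmetric congruentb.
Proof.
by move=> s s'; apply/asboolP/asboolP => h V f /h.
Qed.

Lemma congruentb_trans : transitive congruentb.
Proof.
by move=> s s' s'' /asboolP h /asboolP h'; apply/asboolP => V f rf; rewrite h ?h'.
Qed.

Canonical congruent_equiv :=
  EquivRel congruentb congruentb_refl congruentb_sym congruentb_trans.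

Definition presented := {eq_quot congruent_equiv}%qT.
HB.instance Definition _ := Choice.on presented.

Definition pclass (s : formal_sum) : presented := \pi_presented%qT s.

Definition pgen (t : T) : presented := pclass [:: (1, t)].

Definition pext (V : lmodType rat) (f : T -> V) (u : presented) : V :=
  lincomb f (repr u).

Lemma pext_class (V : lmodType rat) (f : T -> V) s :
  respects f -> pext f (pclass s) = lincomb f s.
Proof.
move=> rf; rewrite /pext /pclass; case: piP => s' /eqmodP/asboolP h.
by rewrite h.
Qed.

Lemma presented_ext (u v : presented) :
  (forall (V : lmodType rat) (f : T -> V), respects f -> pext f u = pext f v) ->
  u = v.
Proof.
move=> h; rewrite -[u]reprK -[v]reprK; apply/eqmodP/asboolP => V f rf.
exact: h.
Qed.

Definition padd (u v : presented) := pclass (repr u ++ repr v).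
Definition pscale (a : rat) (u : presented) :=
  pclass [seq (a * p.1, p.2) | p <- repr u].
Definition popp (u : presented) := pscale (-1) u.
Definition pzero := pclass [::].

Lemma pext_add V f u v : @respects V f ->
  pext f (padd u v) = pext f u + pext f v.
Proof. by move=> rf; rewrite pext_class // /lincomb big_cat. Qed.

Lemma pext_scale V f a u : @respects V f -> pext f (pscale a u) = a *: pext f u.
Proof.
move=> rf; rewrite pext_class // /lincomb big_map scaler_sumr.
by apply: eq_bigr => p _; rewrite scalerA.
Qed.

Lemma pext_zero V f : @respects V f -> pext f pzero = 0.
Proof. by move=> rf; rewrite pext_class // /lincomb big_nil. Qed.

Definition pextE := (pext_add, pext_scale, pext_zero).

Lemma paddA : associative padd.
Proof. by move=> u v w; apply: presented_ext => V f rf; rewrite !pextE ?addrA. Qed.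

Lemma paddC : commutative padd.
Proof. by move=> u v; apply: presented_ext => V f rf; rewrite !pextE // addrC. Qed.

Lemma padd0 : left_id pzero padd.
Proof. by move=> u; apply: presented_ext => V f rf; rewrite !pextE // add0r. Qed.

Lemma paddN : left_inverse pzero popp padd.
Proof.
by move=> u; apply: presented_ext => V f rf; rewrite !pextE // scaleN1r addNr.
Qed.

HB.instance Definition _ := GRing.isZmodule.Build presented paddA paddC padd0 paddN.

Lemma pscaleA a b u : pscale a (pscale b u) = pscale (a * b) u.
Proof. by apply: presented_ext => V f rf; rewrite !pextE // scalerA. Qed.

Lemma pscale1 : left_id 1 pscale.
Proof. by move=> u; apply: presented_ext => V f rf; rewrite !pextE // scale1r. Qed.

Lemma pscaleDr : right_distributive pscale +%R.
Proof.
move=> a u v; apply: presented_ext => V f rf.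
by rewrite !pextE // scalerDr.
Qed.

Lemma pscaleDl u : {morph pscale^~ u : a b / a + b}.
Proof.
move=> a b; apply: presented_ext => V f rf.
by rewrite !pextE // scalerDl.
Qed.

HB.instance Definition _ := GRing.Zmodule_isLmodule.Build rat presented
  pscaleA pscale1 pscaleDr pscaleDl.

Lemma pext_linear V f : @respects V f -> linear (pext f).
Proof. by move=> rf a u v; rewrite pext_add // pext_scale. Qed.

Lemma pext_gen V f t : @respects V f -> pext f (pgen t) = f t.
Proof.
by move=> rf; rewrite pext_class // /lincomb big_seq1 scale1r.
Qed.

Lemma pclassE s : pclass s = lincomb pgen s.
Proof.
apply: presented_ext => V f rf; rewrite pext_class //.
rewrite /lincomb; elim: s => [|p s IH]; first by rewrite !big_nil pext_zero.
by rewrite !big_cons pext_add // pext_scale // pext_gen // IH.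
Qed.

Lemma pgen_respects : respects pgen.
Proof.
move=> r rr; rewrite -pclassE; apply: presented_ext => V f rf.
by rewrite pext_class // rf // pext_zero.
Qed.

Lemma pgen_ext (V : lmodType rat) (f g : {linear presented -> V}) :
  (forall t, f (pgen t) = g (pgen t)) -> f =1 g.
Proof.
move=> fg u; rewrite -[u]reprK -/(pclass _) pclassE /lincomb.
by rewrite !linear_sum; apply: eq_bigr => p _; rewrite !linearZ fg.
Qed.

End Presented.

Lemma lin_ext (U V : lmodType rat) (f g : {linear U -> V}) : f =1 g -> f = g.
Proof.
case: f g => [f cf] [g cg] /= /funext fg; subst g; congr GRing.Linear.Pack.
case: cf cg => [[a] [b]] [[a'] [b']].
by rewrite (Prop_irrelevance a a') (Prop_irrelevance b b').
Qed.

Definition mklin (U V : lmodType rat) (f : U -> V) (lf : linear f) :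
    {linear U -> V} :=
  HB.pack_for {linear U -> V} f (GRing.isLinear.Build rat U V _ f lf).

Definition qmod_cat : category.
Proof.
refine (@Category (lmodType rat) (fun U V => {linear U -> V}) (fun U => idfun)
  (fun U V W f g => g \o f) _ _ _).
- by move=> U V f; apply: lin_ext.
- by move=> U V f; apply: lin_ext.
- by move=> U V W T f g h; apply: lin_ext.
Defined.

(* The direct sum over i : I of the tensor products over Q of M i and N i. *)
Section Tensor.
Variables (I : Type) (M N : I -> lmodType rat).

Definition bilinear_family (V : lmodType rat) (b : forall i, M i -> N i -> V) :=
  (forall i y, linear (fun x => b i x y)) /\ (forall i x, linear (b i x)).

Definition tensor_gen := {i : I & (M i * N i)%type}.

Inductive tensor_rel : seq (rat * tensor_gen) -> Prop :=
| TensorRelL i a x x' y : tensor_rel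
    [:: (1, existT _ i (a *: x + x', y)); (- a, existT _ i (x, y));
        (- 1, existT _ i (x', y))]
| TensorRelR i a x y y' : tensor_rel
    [:: (1, existT _ i (x, a *: y + y')); (- a, existT _ i (x, y));
        (- 1, existT _ i (x, y'))].

Definition sum_tensor : lmodType rat := presented tensor_rel.

Definition ptens i (x : M i) (y : N i) : sum_tensor :=
  pgen tensor_rel (existT _ i (x, y)).

Lemma lincomb3 (V : lmodType rat) (f : tensor_gen -> V) a b c x y z :
  lincomb f [:: (a, x); (b, y); (c, z)] = a *: f x + b *: f y + c *: f z.
Proof. by rewrite /lincomb !big_cons big_nil addr0 addrA. Qed.

Lemma rel3 (V : lmodType rat) a (p q r : V) :
  1 *: p + - a *: q + - 1 *: r = 0 -> p = a *: q + r.
Proof.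
rewrite scale1r !scaleNr scale1r => /eqP.
by rewrite -addrA -opprD subr_eq0 => /eqP.
Qed.

Lemma ptens_bilinear : bilinear_family ptens.
Proof.
split=> i z a x y; apply: rel3; rewrite -lincomb3; apply: pgen_respects.
  exact: TensorRelL.
exact: TensorRelR.
Qed.

Lemma bilinear_respects (V : lmodType rat) (b : forall i, M i -> N i -> V) :
  bilinear_family b ->
  respects tensor_rel
    (fun g : tensor_gen => b (tag g) (tagged g).1 (tagged g).2).
Proof.
case=> bl br r [] i a x x' y; rewrite lincomb3 /= ?bl ?br.
  by rewrite scale1r !scaleNr scale1r -addrA -opprD subrr.
by rewrite scale1r !scaleNr scale1r -addrA -opprD subrr.
Qed.

Definition tlift (V : lmodType rat) (b : forall i, M i -> N i -> V)
    (hb : bilinear_family b) : {linear sum_tensor -> V} :=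
  mklin (pext_linear (bilinear_respects hb)).

Lemma tliftE V b (hb : @bilinear_family V b) i x y :
  tlift hb (ptens x y) = b i x y.
Proof. exact: (pext_gen _ (bilinear_respects hb)). Qed.

Lemma tensor_ext (V : lmodType rat) (f g : {linear sum_tensor -> V}) :
  (forall i (x : M i) (y : N i), f (ptens x y) = g (ptens x y)) -> f =1 g.
Proof. by move=> fg; apply: pgen_ext => -[i [x y]]; apply: fg. Qed.

End Tensor.

Lemma ptens_linl I (M N : I -> lmodType rat) i a (x x' : M i) (y : N i) :
  ptens (a *: x + x') y = a *: ptens x y + ptens x' y.
Proof. exact: (ptens_bilinear M N).1. Qed.

Lemma ptens_linr I (M N : I -> lmodType rat) i a (x : M i) (y y' : N i) :
  ptens x (a *: y + y') = a *: ptens x y + ptens x y'.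
Proof. exact: (ptens_bilinear M N).2. Qed.

Lemma tlift_linear I (M N : I -> lmodType rat) (Z V : lmodType rat)
    (b : Z -> forall i, M i -> N i -> V) (hb : forall z, bilinear_family (b z)) :
  (forall i x y, linear (fun z => b z i x y)) ->
  forall u, linear (fun z => tlift (hb z) u).
Proof.
move=> hz u a z z'.
apply: (@tensor_ext _ _ _ _ (tlift (hb (a *: z + z')))
  ((a \*: tlift (hb z)) \+ tlift (hb z'))) => i x y.
rewrite -[RHS]/(a *: tlift (hb z) (ptens x y) + tlift (hb z') (ptens x y)).
by rewrite !tliftE hz.
Qed.

Definition qtens (U V : lmodType rat) : lmodType rat :=
  sum_tensor (fun _ : unit => U) (fun _ : unit => V).

Definition qt (U V : lmodType rat) (x : U) (y : V) : qtens U V :=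
  @ptens unit (fun=> U) (fun=> V) tt x y.

Lemma qt_linl (U V : lmodType rat) a (x x' : U) (y : V) :
  qt (a *: x + x') y = a *: qt x y + qt x' y.
Proof. exact: ptens_linl. Qed.

Lemma qt_linr (U V : lmodType rat) a (x : U) (y y' : V) :
  qt x (a *: y + y') = a *: qt x y + qt x y'.
Proof. exact: ptens_linr. Qed.

Lemma qt_ext (U V W : lmodType rat) (f g : {linear qtens U V -> W}) :
  (forall x y, f (qt x y) = g (qt x y)) -> f =1 g.
Proof. by move=> fg; apply: tensor_ext => -[]. Qed.

Definition qbilinear (U V W : lmodType rat) (b : U -> V -> W) :=
  (forall y, linear (b^~ y)) /\ (forall x, linear (b x)).

Lemma qlift_subproof (U V W : lmodType rat) (b : U -> V -> W) :
  qbilinear b -> @bilinear_family unit (fun=> U) (fun=> V) W (fun _ => b).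
Proof. by case=> bl br; split=> _. Qed.

Definition qlift (U V W : lmodType rat) (b : U -> V -> W) (hb : qbilinear b) :
  {linear qtens U V -> W} := tlift (qlift_subproof hb).

Lemma qliftE (U V W : lmodType rat) b (hb : @qbilinear U V W b) x y :
  qlift hb (qt x y) = b x y.
Proof. exact: (tliftE (qlift_subproof hb)). Qed.

Section QmodMaps.
Variables U U' V V' W : lmodType rat.

Lemma qtensm_subproof (f : {linear U -> U'}) (g : {linear V -> V'}) :
  qbilinear (fun x y => qt (f x) (g y)).
Proof. by split=> z a x y; rewrite linearP ?qt_linl ?qt_linr. Qed.

Definition qtensm (f : {linear U -> U'}) (g : {linear V -> V'}) :
  {linear qtens U V -> qtens U' V'} := qlift (qtensm_subproof f g).

Lemma qassoc_subproof1 (z : W) : qbilinear (fun (x : U) (y : V) => qt x (qt y z)).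
Proof. by split=> t a x y; rewrite ?qt_linl ?qt_linr. Qed.

Lemma qassoc_subproof2 :
  qbilinear (fun (u : qtens U V) z => qlift (qassoc_subproof1 z) u).
Proof.
split=> [z a u u'|u]; first by rewrite linearP.
by apply: tlift_linear => _ x y a z z'; rewrite !qt_linr.
Qed.

Definition qassoc : {linear qtens (qtens U V) W -> qtens U (qtens V W)} :=
  qlift qassoc_subproof2.

Lemma qassocE x y z : qassoc (qt (qt x y) z) = qt x (qt y z).
Proof. by rewrite !qliftE. Qed.

Lemma qassoci_subproof1 (x : U) : qbilinear (fun (y : V) (z : W) => qt (qt x y) z).
Proof. by split=> t a y z; rewrite ?(qt_linl, qt_linr). Qed.

Lemma qassoci_subproof2 :
  qbilinear (fun (x : U) u => qlift (qassoci_subproof1 x) u).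
Proof.
split=> [u|x a u u']; last by rewrite linearP.
by apply: tlift_linear => _ y z a x x'; rewrite !qt_linl.
Qed.

Definition qassoci : {linear qtens U (qtens V W) -> qtens (qtens U V) W} :=
  qlift qassoci_subproof2.

Lemma qassociE x y z : qassoci (qt x (qt y z)) = qt (qt x y) z.
Proof. by rewrite !qliftE. Qed.

Lemma qlunit_subproof : qbilinear (fun (a : rat^o) (x : U) => a *: x).
Proof.
split=> t a x y; first by rewrite scalerDl scalerA.
by rewrite scalerDr !scalerA mulrC.
Qed.

Definition qlunit : {linear qtens rat^o U -> U} := qlift qlunit_subproof.

Lemma qluniti_subproof : linear (fun x : U => qt (1 : rat^o) x).
Proof. by move=> a x y; rewrite qt_linr. Qed.

Definition qluniti : {linear U -> qtens rat^o U} := mklin qluniti_subproof.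

Lemma qrunit_subproof : qbilinear (fun (x : U) (a : rat^o) => a *: x).
Proof.
split=> t a x y; last by rewrite scalerDl scalerA.
by rewrite scalerDr !scalerA mulrC.
Qed.

Definition qrunit : {linear qtens U rat^o -> U} := qlift qrunit_subproof.

Lemma qruniti_subproof : linear (fun x : U => qt x (1 : rat^o)).
Proof. by move=> a x y; exact: qt_linl. Qed.

Definition qruniti : {linear U -> qtens U rat^o} := mklin qruniti_subproof.

Lemma qbraid_subproof : qbilinear (fun (x : U) (y : V) => qt y x).
Proof. by split=> t a x y; rewrite ?qt_linl ?qt_linr. Qed.

Definition qbraid : {linear qtens U V -> qtens V U} := qlift qbraid_subproof.

Lemma qtensmE f g x y : qtensm f g (qt x y) = qt (f x) (g y).
Proof. exact: qliftE. Qed.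

Lemma qbraidE x y : qbraid (qt x y) = qt y x.
Proof. exact: qliftE. Qed.

Lemma qlunitE a x : qlunit (qt a x) = a *: x.
Proof. exact: qliftE. Qed.

Lemma qrunitE a x : qrunit (qt x a) = a *: x.
Proof. exact: qliftE. Qed.

Lemma qlunitiE x : qluniti x = qt (1 : rat^o) x.
Proof. by []. Qed.

Lemma qrunitiE x : qruniti x = qt x (1 : rat^o).
Proof. by []. Qed.

End QmodMaps.

Section QtScale.
Variables U V : lmodType rat.

Lemma qt0l (y : V) : qt (0 : U) y = 0.
Proof. by have := qt_linl (-1) (0 : U) 0 y; rewrite !scaleN1r !addNr. Qed.

Lemma qt0r (x : U) : qt x (0 : V) = 0.
Proof. by have := qt_linr (-1) x (0 : V) 0; rewrite !scaleN1r !addNr. Qed.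

Lemma qtZl a (x : U) (y : V) : qt (a *: x) y = a *: qt x y.
Proof. by have := qt_linl a x 0 y; rewrite qt0l !addr0. Qed.

Lemma qtZr a (x : U) (y : V) : qt x (a *: y) = a *: qt x y.
Proof. by have := qt_linr a x y 0; rewrite qt0r !addr0. Qed.

End QtScale.

Lemma qt_scale_unitl (U : lmodType rat) (a : rat^o) (x : U) :
  qt (1 : rat^o) (a *: x) = qt a x.
Proof.
by rewrite qtZr -qtZl /GRing.scale /= mulr1.
Qed.

Lemma qmod_compE (U V W : qmod_cat) (f : U ~> V) (g : V ~> W) (x : U) :
  (f >> g : {linear U -> W}) x =
  (g : {linear V -> W}) ((f : {linear U -> V}) x).
Proof. by []. Qed.

Lemma qmod_idE (U : qmod_cat) (x : U) : (idm U : {linear U -> U}) x = x.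
Proof. by []. Qed.

Definition qE := (qmod_compE, qmod_idE, qtensmE, qassocE, qassociE, qlunitE, qrunitE, qlunitiE,
  qrunitiE,
  qbraidE).

Lemma qt_ext3 (U V W T : lmodType rat) (f g : {linear qtens (qtens U V) W -> T}) :
  (forall x y z, f (qt (qt x y) z) = g (qt (qt x y) z)) -> f =1 g.
Proof.
move=> fg; apply: qt_ext => u z.
have lz : linear (fun u : qtens U V => qt u z) by move=> a x y; exact: qt_linl.
by apply: (@qt_ext _ _ _ (f \o mklin lz) (g \o mklin lz)) => x y; apply: fg.
Qed.

Lemma qt_ext3r (U V W T : lmodType rat) (f g : {linear qtens U (qtens V W) -> T}) :
  (forall x y z, f (qt x (qt y z)) = g (qt x (qt y z))) -> f =1 g.
Proof.
move=> fg; apply: qt_ext => x u.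
have lx : linear (qt x : qtens V W -> _) by move=> a y z; exact: qt_linr.
by apply: (@qt_ext _ _ _ (f \o mklin lx) (g \o mklin lx)) => y z; apply: fg.
Qed.

Lemma qt_ext4 (U V W X T : lmodType rat)
    (f g : {linear qtens (qtens (qtens U V) W) X -> T}) :
  (forall x y z t, f (qt (qt (qt x y) z) t) = g (qt (qt (qt x y) z) t)) ->
  f =1 g.
Proof.
move=> fg; apply: qt_ext => u t.
have lt : linear (fun u : qtens (qtens U V) W => qt u t) by move=> a x y; exact: qt_linl.
by apply: (@qt_ext3 _ _ _ _ (f \o mklin lt) (g \o mklin lt)) => x y z; apply: fg.
Qed.

Definition qmod_symmon : symmoncat.
Proof.
refine (@SymMonCat qmod_cat (rat^o : lmodType rat) qtens
  (fun U U' V V' f g => qtensm f g)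
  (fun U V W => qassoc U V W) (fun U V W => qassoci U V W)
  (fun U => qlunit U) (fun U => qluniti U)
  (fun U => qrunit U) (fun U => qruniti U) (fun U V => qbraid U V)
  _ _ _ _ _ _ _ _ _ _ _ _ _ _ _ _).
- by move=> U V; apply/lin_ext/qt_ext => x y; rewrite !qE.
- by move=> *; apply/lin_ext/qt_ext => x y; rewrite !qE.
- by move=> *; apply/lin_ext/qt_ext3 => x y z; rewrite !qE.
- by move=> *; apply/lin_ext/qt_ext3 => x y z; rewrite !qE.
- by move=> *; apply/lin_ext/qt_ext3r => x y z; rewrite !qE.
- by move=> *; apply/lin_ext/qt_ext => x y; rewrite !qE linearZ.
- by move=> *; apply/lin_ext/qt_ext => x y; rewrite !qE qt_scale_unitl.
- by move=> *; apply/lin_ext => x; rewrite !qE scale1r.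
- by move=> *; apply/lin_ext/qt_ext => x y; rewrite !qE linearZ.
- move=> U; apply/lin_ext/qt_ext => x y; rewrite !qE.
  by rewrite -[LHS](qbraidE (1 : rat^o)) qt_scale_unitl qbraidE.
- by move=> *; apply/lin_ext => x; rewrite !qE scale1r.
- by move=> *; apply/lin_ext/qt_ext => x y; rewrite !qE.
- by move=> *; apply/lin_ext/qt_ext => x y; rewrite !qE.
- by move=> *; apply/lin_ext/qt_ext4 => x y z t; rewrite !qE.
- move=> U V; apply/lin_ext/qt_ext3 => x a y; rewrite !qE.
  by rewrite qtZr qtZl.
- by move=> *; apply/lin_ext/qt_ext3 => x y z; rewrite !qE.
Defined.

Record chain := Chain {
  cdeg :> nat -> lmodType rat;
  cd : forall n, {linear cdeg n.+1 -> cdeg n};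
  cdd : forall n (x : cdeg n.+2), cd n (cd n.+1 x) = 0 }.
Arguments cd {c n}.

Record chain_map (X Y : chain) := ChainMap {
  cfun :> forall n, {linear X n -> Y n};
  cfun_d : forall n (x : X n.+1), cfun n (cd x) = cd (cfun n.+1 x) }.

Lemma chain_map_ext (X Y : chain) (f g : chain_map X Y) :
  (forall n, f n =1 g n) -> f = g.
Proof.
case: f g => [f ef] [g eg] /= fgE.
have fg : f = g by apply: functional_extensionality_dep => n; exact: (lin_ext (fgE n)).
by subst g; congr ChainMap; apply: Prop_irrelevance.
Qed.

Lemma chain_comp_subproof (X Y Z : chain) (f : chain_map X Y)
    (g : chain_map Y Z) n (x : X n.+1) :
  (g n \o f n) (cd x) = cd ((g n.+1 \o f n.+1) x).
Proof. by rewrite /= !cfun_d. Qed.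

Definition chain_cat : category.
Proof.
refine (@Category chain chain_map
  (fun X => @ChainMap X X (fun n => idfun) (fun _ _ => erefl))
  (fun X Y Z f g => @ChainMap X Z (fun n => g n \o f n)
    (chain_comp_subproof f g)) _ _ _).
- by move=> X Y f; apply: chain_map_ext.
- by move=> X Y f; apply: chain_map_ext.
- by move=> X Y Z T f g h; apply: chain_map_ext.
Defined.

Record split_deg (n : nat) := SplitDeg {
  degl : nat; degr : nat; degE : (degl + degr)%N = n }.

Section ChainTensor.
Variables X Y : chain.

(* The direct sum of the X i (x) Y j over i + j = n. *)
Definition ctens_deg (n : nat) : lmodType rat :=
  sum_tensor (fun p : split_deg n => X (degl p)) (fun p => Y (degr p)).

Definition ct n i j (e : (i + j)%N = n) (x : X i) (y : Y j) : ctens_deg n :=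
  @ptens (split_deg n) (fun p => X (degl p)) (fun p => Y (degr p))
    (SplitDeg e) x y.

Lemma ct_linl n i j (e : (i + j)%N = n) a (x x' : X i) (y : Y j) :
  ct e (a *: x + x') y = a *: ct e x y + ct e x' y.
Proof. by rewrite /ct ptens_linl. Qed.

Lemma ct_linr n i j (e : (i + j)%N = n) a (x : X i) (y y' : Y j) :
  ct e x (a *: y + y') = a *: ct e x y + ct e x y'.
Proof. by rewrite /ct ptens_linr. Qed.

Lemma ct0l n i j (e : (i + j)%N = n) (y : Y j) : ct e 0 y = 0.
Proof. by have := ct_linl e (-1) 0 0 y; rewrite !scaleN1r !addNr. Qed.

Lemma ct0r n i j (e : (i + j)%N = n) (x : X i) : ct e x 0 = 0.
Proof. by have := ct_linr e (-1) x 0 0; rewrite !scaleN1r !addNr. Qed.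

Lemma ctZl n i j (e : (i + j)%N = n) a (x : X i) (y : Y j) :
  ct e (a *: x) y = a *: ct e x y.
Proof. by have := ct_linl e a x 0 y; rewrite ct0l !addr0. Qed.

Lemma ctZr n i j (e : (i + j)%N = n) a (x : X i) (y : Y j) :
  ct e x (a *: y) = a *: ct e x y.
Proof. by have := ct_linr e a x y 0; rewrite ct0r !addr0. Qed.

Lemma ctDl n i j (e : (i + j)%N = n) (x x' : X i) (y : Y j) :
  ct e (x + x') y = ct e x y + ct e x' y.
Proof. by have := ct_linl e 1 x x' y; rewrite !scale1r. Qed.

Lemma ctDr n i j (e : (i + j)%N = n) (x : X i) (y y' : Y j) :
  ct e x (y + y') = ct e x y + ct e x y'.
Proof. by have := ct_linr e 1 x y y'; rewrite !scale1r. Qed.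

Lemma ct_irr n i j (e e' : (i + j)%N = n) (x : X i) (y : Y j) :
  ct e x y = ct e' x y.
Proof. by rewrite (eq_irrelevance e e'). Qed.

Lemma ct_ext n (V : lmodType rat) (f g : {linear ctens_deg n -> V}) :
  (forall i j (e : (i + j)%N = n) x y, f (ct e x y) = g (ct e x y)) -> f =1 g.
Proof. by move=> fg; apply: tensor_ext => -[i j e] x y; apply: fg. Qed.

Section Lift.
Variables (n : nat) (V : lmodType rat).
Variable b : forall i j, (i + j)%N = n -> X i -> Y j -> V.
Arguments b {i j}.

Definition cbilinear :=
  (forall i j (e : (i + j)%N = n) y, linear (fun x => b e x y)) /\
  (forall i j (e : (i + j)%N = n) x, linear (b e x)).

Hypothesis hb : cbilinear.

Lemma clift_subproof :
  @bilinear_family (split_deg n) (fun p => X (degl p)) (fun p => Y (degr p)) V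
    (fun p => b (degE p)).
Proof. by case: hb => bl br; split=> p z; [apply: bl | apply: br]. Qed.

Definition clift : {linear ctens_deg n -> V} := tlift clift_subproof.

Lemma cliftE i j (e : (i + j)%N = n) x y : clift (ct e x y) = b e x y.
Proof. exact: (tliftE clift_subproof). Qed.

End Lift.

Definition dl n i j : (i + j)%N = n.+1 -> X i -> Y j -> ctens_deg n :=
  match i with
  | 0 => fun _ _ _ => 0
  | i'.+1 => fun e x y => ct (succn_inj e) (cd x) y
  end.

Definition dr n i j : (i + j)%N = n.+1 -> X i -> Y j -> ctens_deg n :=
  match j with
  | 0 => fun _ _ _ => 0
  | j'.+1 => fun e x y =>
      ct (succn_inj (etrans (esym (addnS i j')) e)) x (cd y)
  end.

Lemma dl0 n j (e : (0 + j)%N = n.+1) x y : @dl n 0 j e x y = 0.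
Proof. by []. Qed.

Lemma dlS n i j (e : (i.+1 + j)%N = n.+1) x y :
  dl e x y = ct (succn_inj e) (cd x) y.
Proof. by []. Qed.

Lemma dr0 n i (e : (i + 0)%N = n.+1) x y : @dr n i 0 e x y = 0.
Proof. by []. Qed.

Lemma drS n i j (e : (i + j.+1)%N = n.+1) x y :
  dr e x y = ct (succn_inj (etrans (esym (addnS i j)) e)) x (cd y).
Proof. by []. Qed.

Lemma ctens_d_subproof n :
  cbilinear (fun i j (e : (i + j)%N = n.+1) x y =>
    dl e x y + (-1) ^+ i *: dr e x y).
Proof.
split=> i j e z a x y.
  have -> : dl e (a *: x + y) z = a *: dl e x z + dl e y z.
    by case: i e x y => [|i] e x y /=; rewrite ?(linearP, ct_linl) // scaler0 addr0.
  have -> : dr e (a *: x + y) z = a *: dr e x z + dr e y z.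
    by case: j e z => [|j] e z /=; rewrite ?(linearP, ct_linl) // scaler0 addr0.
  by rewrite !scalerDr !scalerA mulrC addrACA.
have -> : dl e z (a *: x + y) = a *: dl e z x + dl e z y.
  by case: i e z => [|i] e z /=; rewrite ?(linearP, ct_linr) // scaler0 addr0.
have -> : dr e z (a *: x + y) = a *: dr e z x + dr e z y.
  by case: j e x y => [|j] e x y /=; rewrite ?(linearP, ct_linr) // scaler0 addr0.
by rewrite !scalerDr !scalerA mulrC addrACA.
Qed.

(* d (x (x) y) = d x (x) y + (-1)^|x| x (x) d y. *)
Definition ctens_d n : {linear ctens_deg n.+1 -> ctens_deg n} :=
  clift (ctens_d_subproof n).

Lemma ctens_dE n i j (e : (i + j)%N = n.+1) x y :
  ctens_d n (ct e x y) = dl e x y + (-1) ^+ i *: dr e x y.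
Proof. exact: (cliftE (ctens_d_subproof n)). Qed.

Lemma ctens_dd n (u : ctens_deg n.+2) : ctens_d n (ctens_d n.+1 u) = 0.
Proof.
apply: (@ct_ext n.+2 _ (ctens_d n \o ctens_d n.+1) \0) => i j e x y.
rewrite -[LHS]/(ctens_d n (ctens_d n.+1 (ct e x y))) -[RHS]/0 ctens_dE.
rewrite linearD linearZZ.
case: i e x => [|i] e x; case: j e y => [|j] e y.
- by rewrite dl0 dr0 linear0 scaler0 addr0.
- rewrite dl0 linear0 add0r drS ctens_dE dl0 add0r.
  case: j e y => [|j] e y; first by rewrite dr0 !scaler0.
  by rewrite drS cdd ct0r !scaler0.
- rewrite dr0 linear0 scaler0 addr0 dlS ctens_dE dr0 scaler0 addr0.
  by case: i e x => [|i] e x; rewrite ?dl0 // dlS cdd ct0l.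
- rewrite dlS drS !ctens_dE dlS drS.
  have -> : dl (succn_inj e) (cd x) y = 0.
    by case: i e x => [|i] e x //; rewrite dlS cdd ct0l.
  have -> : dr (succn_inj (etrans (esym (addnS i.+1 j)) e)) x (cd y) = 0.
    by case: j e y => [|j] e y //; rewrite drS cdd ct0r.
  rewrite scaler0 addr0 add0r exprS mulN1r scaleNr.
  by apply/eqP; rewrite subr_eq0; apply/eqP; congr (_ *: _); apply: ct_irr.
Qed.

Definition ctens : chain := Chain ctens_dd.

End ChainTensor.

Section ChainTensorMap.
Variables (X X' Y Y' : chain) (f : chain_map X X') (g : chain_map Y Y').

Lemma ctensm_subproof n :
  cbilinear (fun i j (e : (i + j)%N = n) (x : X i) (y : Y j) =>
    ct e (f i x) (g j y)).
Proof. by split=> i j e z a x y; rewrite linearP ?ct_linl ?ct_linr. Qed.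

Definition ctensm_deg n : {linear ctens X Y n -> ctens X' Y' n} :=
  clift (ctensm_subproof n).

Lemma ctensm_degE n i j (e : (i + j)%N = n) x y :
  ctensm_deg n (ct e x y) = ct e (f i x) (g j y).
Proof. exact: (cliftE (ctensm_subproof n)). Qed.

Lemma ctensm_d n (u : ctens X Y n.+1) :
  ctensm_deg n (cd u) = cd (ctensm_deg n.+1 u).
Proof.
apply: (@ct_ext _ _ n.+1 _ (ctensm_deg n \o ctens_d X Y n)
  (ctens_d X' Y' n \o ctensm_deg n.+1)) => i j e x y.
rewrite -[LHS]/(ctensm_deg n (ctens_d X Y n (ct e x y))).
rewrite -[RHS]/(ctens_d X' Y' n (ctensm_deg n.+1 (ct e x y))).
rewrite ctensm_degE !ctens_dE linearD linearZZ; congr (_ + _ *: _).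
  case: i e x => [|i] e x; first by rewrite !dl0 linear0.
  by rewrite !dlS ctensm_degE cfun_d.
case: j e y => [|j] e y; first by rewrite !dr0 linear0.
by rewrite !drS ctensm_degE cfun_d.
Qed.

Definition ctensm : chain_map (ctens X Y) (ctens X' Y') := ChainMap ctensm_d.

Lemma ctensmE n i j (e : (i + j)%N = n) x y :
  ctensm n (ct e x y) = ct e (f i x) (g j y).
Proof. exact: ctensm_degE. Qed.

End ChainTensorMap.

Lemma ctens_cdE (X Y : chain) n i j (e : (i + j)%N = n.+1) (x : X i) (y : Y j) :
  (cd : {linear ctens X Y n.+1 -> ctens X Y n}) (ct e x y) =
  dl e x y + (-1) ^+ i *: dr e x y.
Proof. exact: ctens_dE. Qed.

Section CtExt.
Variables X Y Z T : chain.

Lemma ct_linear_l n i j (e : (i + j)%N = n) (y : Y j) :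
  linear (fun x : X i => ct e x y).
Proof. by move=> a x x'; apply: ct_linl. Qed.

Lemma ct_linear_r n i j (e : (i + j)%N = n) (x : X i) :
  linear (fun y : Y j => ct e x y).
Proof. by move=> a y y'; apply: ct_linr. Qed.

End CtExt.

Lemma ct_ext3 (X Y Z : chain) n (V : lmodType rat)
    (f g : {linear ctens (ctens X Y) Z n -> V}) :
  (forall i l (e : (i + l)%N = n) a b (e' : (a + b)%N = i)
     (x : X a) (y : Y b) (z : Z l),
    f (ct e (ct e' x y : ctens X Y i) z) =
    g (ct e (ct e' x y : ctens X Y i) z)) -> f =1 g.
Proof.
move=> fg; apply: ct_ext => i l e u z.
pose h := mklin (@ct_linear_l (ctens X Y) Z n i l e z).
by apply: (@ct_ext _ _ _ _ (f \o h) (g \o h)) => a b e' x y; apply: fg.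
Qed.

Lemma ct_ext3r (X Y Z : chain) n (V : lmodType rat)
    (f g : {linear ctens X (ctens Y Z) n -> V}) :
  (forall a i (e : (a + i)%N = n) b l (e' : (b + l)%N = i)
     (x : X a) (y : Y b) (z : Z l),
    f (ct e x (ct e' y z : ctens Y Z i)) =
    g (ct e x (ct e' y z : ctens Y Z i))) -> f =1 g.
Proof.
move=> fg; apply: ct_ext => a i e x u.
pose h := mklin (@ct_linear_r X (ctens Y Z) n a i e x).
by apply: (@ct_ext _ _ _ _ (f \o h) (g \o h)) => b l e' y z; apply: fg.
Qed.

Lemma ct_ext4 (X Y Z T : chain) n (V : lmodType rat)
    (f g : {linear ctens (ctens (ctens X Y) Z) T n -> V}) :
  (forall i l (e : (i + l)%N = n) j k (e' : (j + k)%N = i)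
     a b (e'' : (a + b)%N = j) (x : X a) (y : Y b) (z : Z k) (t : T l),
    f (ct e (ct e' (ct e'' x y : ctens X Y j) z : ctens (ctens X Y) Z i) t) =
    g (ct e (ct e' (ct e'' x y : ctens X Y j) z : ctens (ctens X Y) Z i) t)) ->
  f =1 g.
Proof.
move=> fg; apply: ct_ext => i l e u t.
pose h := mklin (@ct_linear_l (ctens (ctens X Y) Z) T n i l e t).
by apply: (@ct_ext3 _ _ _ _ _ (f \o h) (g \o h)) => *; apply: fg.
Qed.

Section ChainAssoc.
Variables X Y Z : chain.

Section AssocDeg.
Variable n : nat.

Lemma assoc_deg a b l i : (i + l)%N = n -> (a + b)%N = i ->
  (a + (b + l))%N = n.
Proof. by move=> <- <-; rewrite addnA. Qed.

Lemma associ_deg a b l i : (a + i)%N = n -> (b + l)%N = i ->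
  (a + b + l)%N = n.
Proof. by move=> <- <-; rewrite addnA. Qed.

Lemma cassoc_subproof1 i l (e : (i + l)%N = n) (z : Z l) :
  cbilinear (fun a b (e' : (a + b)%N = i) (x : X a) (y : Y b) =>
    ct (assoc_deg e e') x (ct erefl y z : ctens Y Z (b + l)%N)).
Proof. by split=> a b e' t c x y; rewrite ?(ct_linl, ct_linr). Qed.

Lemma cassoc_subproof2 :
  cbilinear (fun i l (e : (i + l)%N = n) (u : ctens X Y i) (z : Z l) =>
    clift (cassoc_subproof1 e z) u).
Proof.
split=> [i l e z a u u'|i l e u]; first by rewrite linearP.
by apply: tlift_linear => -[c d e'] x y a z z'; rewrite !ct_linr.
Qed.

Definition cassoc_n : {linear ctens (ctens X Y) Z n -> ctens X (ctens Y Z) n} :=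
  clift cassoc_subproof2.

Lemma cassoc_nE i l a b m (e : (i + l)%N = n) (e' : (a + b)%N = i)
    (E : (a + m)%N = n) (E' : (b + l)%N = m) (x : X a) (y : Y b) (z : Z l) :
  cassoc_n (ct e (ct e' x y : ctens X Y i) z) =
  ct E x (ct E' y z : ctens Y Z m).
Proof.
by rewrite [LHS]cliftE [LHS]cliftE; case: m / E' in E *; apply: ct_irr.
Qed.

Lemma cassoci_subproof1 a i (e : (a + i)%N = n) (x : X a) :
  cbilinear (fun b l (e' : (b + l)%N = i) (y : Y b) (z : Z l) =>
    ct (associ_deg e e') (ct erefl x y : ctens X Y (a + b)%N) z).
Proof. by split=> b l e' t c y z; rewrite ?(ct_linl, ct_linr). Qed.

Lemma cassoci_subproof2 :
  cbilinear (fun a i (e : (a + i)%N = n) (x : X a) (u : ctens Y Z i) =>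
    clift (cassoci_subproof1 e x) u).
Proof.
split=> [a i e u|a i e u c v v']; last by rewrite linearP.
by apply: tlift_linear => -[c d e'] x y b z z'; rewrite !ct_linl.
Qed.

Definition cassoci_n : {linear ctens X (ctens Y Z) n -> ctens (ctens X Y) Z n} :=
  clift cassoci_subproof2.

Lemma cassoci_nE i l a b m (e : (i + l)%N = n) (e' : (a + b)%N = i)
    (E : (a + m)%N = n) (E' : (b + l)%N = m) (x : X a) (y : Y b) (z : Z l) :
  cassoci_n (ct E x (ct E' y z : ctens Y Z m)) =
  ct e (ct e' x y : ctens X Y i) z.
Proof.
by rewrite [LHS]cliftE [LHS]cliftE; case: i / e' in e *; apply: ct_irr.
Qed.

End AssocDeg.

Lemma cassoc_d n (u : ctens (ctens X Y) Z n.+1) :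
  cassoc_n n (cd u) = cd (cassoc_n n.+1 u).
Proof.
apply: (@ct_ext3 _ _ _ n.+1 _ (cassoc_n n \o cd) (cd \o cassoc_n n.+1))
  => i l e a b e' x y z.
rewrite -[LHS]/(cassoc_n n (@cd (ctens (ctens X Y) Z) n
  (ct e (ct e' x y : ctens X Y i) z))).
rewrite -[RHS]/(@cd (ctens X (ctens Y Z)) n (cassoc_n n.+1
  (ct e (ct e' x y : ctens X Y i) z))).
have [m E'] : exists m, (b + l)%N = m by exists (b + l)%N.
have E : (a + m)%N = n.+1 by rewrite -E' -e -e' addnA.
have S : (-1) ^+ i = (-1) ^+ a * (-1) ^+ b :> rat by rewrite -e' exprD.
rewrite (cassoc_nE e e' E E') !ctens_cdE linearD linearZZ S {S}.
have LD u1 u2 : cassoc_n n (u1 + u2) = cassoc_n n u1 + cassoc_n n u2.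
  exact: linearD.
have LZ c u1 : cassoc_n n (c *: u1) = c *: cassoc_n n u1 by exact: linearZZ.
case: a x e' E => [|a] x e' E; case: b y e' E' => [|b] y e' E';
case: l z e E' => [|l] z e E';
  case: i e e' => [|i] e e'; try discriminate e'; try discriminate e;
  case: m E E' => [|m] E E'; try discriminate E'; try discriminate E.
all: rewrite ?(dl0, dr0, dlS, drS, ctens_cdE, linear0, scaler0, addr0, add0r).
all: rewrite ?(ctDl, ctDr, ctZl, ctZr) ?(LD, LZ) ?(scalerDr, scalerA) -?addrA.
all: repeat congr (_ + _); try congr (_ *: _).
all: exact: cassoc_nE.
Qed.

Definition cassoc : chain_map (ctens (ctens X Y) Z) (ctens X (ctens Y Z)) :=
  ChainMap cassoc_d.

Lemma cassocE n i l a b m (e : (i + l)%N = n) (e' : (a + b)%N = i)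
    (E : (a + m)%N = n) (E' : (b + l)%N = m) (x : X a) (y : Y b) (z : Z l) :
  cassoc n (ct e (ct e' x y : ctens X Y i) z) =
  ct E x (ct E' y z : ctens Y Z m).
Proof. exact: cassoc_nE. Qed.

Lemma cassoc_nK n : cancel (cassoc_n n) (cassoci_n n).
Proof.
apply: (@ct_ext3 _ _ _ n _ (cassoci_n n \o cassoc_n n) idfun)
  => i l e a b e' x y z.
rewrite -[LHS]/(cassoci_n n (cassoc_n n (ct e (ct e' x y : ctens X Y i) z))).
rewrite -[RHS]/(ct e (ct e' x y : ctens X Y i) z).
by rewrite (cassoc_nE e e' (assoc_deg e e') erefl) (cassoci_nE e e').
Qed.

Lemma cassoci_nK n : cancel (cassoci_n n) (cassoc_n n).
Proof.
apply: (@ct_ext3r _ _ _ n _ (cassoc_n n \o cassoci_n n) idfun)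
  => a i e b l e' x y z.
rewrite -[LHS]/(cassoc_n n (cassoci_n n (ct e x (ct e' y z : ctens Y Z i)))).
rewrite -[RHS]/(ct e x (ct e' y z : ctens Y Z i)).
by rewrite (cassoci_nE (associ_deg e e') erefl) (cassoc_nE _ _ e e').
Qed.

Lemma cassoci_d n (u : ctens X (ctens Y Z) n.+1) :
  cassoci_n n (cd u) = cd (cassoci_n n.+1 u).
Proof. by rewrite -{1}[u]cassoci_nK -cassoc_d cassoc_nK. Qed.

Definition cassoci : chain_map (ctens X (ctens Y Z)) (ctens (ctens X Y) Z) :=
  ChainMap cassoci_d.

End ChainAssoc.

Section ChainBraid.
Variables X Y : chain.

Lemma braid_deg n i j : (i + j)%N = n -> (j + i)%N = n.
Proof. by rewrite addnC. Qed.

Lemma cbraid_subproof n :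
  cbilinear (fun i j (e : (i + j)%N = n) (x : X i) (y : Y j) =>
    (-1) ^+ (i * j) *: ct (braid_deg e) y x).
Proof.
by split=> i j e z a x y; rewrite ?ct_linl ?ct_linr scalerDr !scalerA mulrC.
Qed.

(* The Koszul sign: x (x) y goes to (-1)^(|x||y|) y (x) x. *)
Definition cbraid_n n : {linear ctens X Y n -> ctens Y X n} :=
  clift (cbraid_subproof n).

Lemma cbraid_nE n i j (e : (i + j)%N = n) (e' : (j + i)%N = n) (x : X i)
    (y : Y j) : cbraid_n n (ct e x y) = (-1) ^+ (i * j) *: ct e' y x.
Proof. by rewrite [LHS]cliftE (ct_irr _ e'). Qed.

Lemma cbraid_d n (u : ctens X Y n.+1) : cbraid_n n (cd u) = cd (cbraid_n n.+1 u).
Proof.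
apply: (@ct_ext _ _ n.+1 _ (cbraid_n n \o @cd (ctens X Y) n)
  (@cd (ctens Y X) n \o cbraid_n n.+1)) => i j e x y.
rewrite -[LHS]/(cbraid_n n (@cd (ctens X Y) n (ct e x y))).
rewrite -[RHS]/(@cd (ctens Y X) n (cbraid_n n.+1 (ct e x y))).
rewrite (cbraid_nE e (braid_deg e)) linearZZ !ctens_cdE linearD linearZZ.
rewrite addrC scalerDr; congr (_ + _).
  case: j e y => [|j] e y; first by rewrite dl0 dr0 linear0 !scaler0.
  rewrite dlS drS (cbraid_nE _ (succn_inj (braid_deg e))) scalerA -exprD.
  by rewrite mulnS.
case: i e x => [|i] e x; first by rewrite dl0 dr0 linear0 !scaler0.
rewrite dlS drS scalerA -exprD mulSn addnAC addnn.
rewrite (cbraid_nE _ (succn_inj (etrans (esym (addnS j i)) (braid_deg e)))).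
by rewrite exprD -[(-1) ^+ j.*2]signr_odd odd_double mul1r.
Qed.

Definition cbraid : chain_map (ctens X Y) (ctens Y X) := ChainMap cbraid_d.

Lemma cbraidE n i j (e : (i + j)%N = n) (e' : (j + i)%N = n) (x : X i)
    (y : Y j) : cbraid n (ct e x y) = (-1) ^+ (i * j) *: ct e' y x.
Proof. exact: cbraid_nE. Qed.

End ChainBraid.

(* The complex with Q in the degrees k such that b k, and zero differential. *)
Section Concentrated.
Variable b : nat -> bool.

Lemma concentrated_dd n (x : 'rV[rat]_(b n.+2)) :
  (\0 : {linear 'rV[rat]_(b n.+1) -> 'rV[rat]_(b n)})
    ((\0 : {linear 'rV[rat]_(b n.+2) -> 'rV[rat]_(b n.+1)}) x) = 0.
Proof. by []. Qed.

Definition concentrated : chain :=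
  @Chain (fun k => 'rV[rat]_(b k)) (fun n => \0) concentrated_dd.

End Concentrated.

Definition cunit : chain := concentrated (fun k => k == 0).

Section ChainUnit.
Variable X : chain.

Definition degcast m n (e : m = n) (x : X m) : X n := ecast k (X k) e x.

Lemma degcast_linear m n (e : m = n) : linear (degcast e).
Proof. by case: n / e. Qed.

Lemma degcast_irr m n (e e' : m = n) x : degcast e x = degcast e' x.
Proof. by rewrite (eq_irrelevance e e'). Qed.

Lemma degcast_d m n (e : m.+1 = n.+1) (e' : m = n) (x : X m.+1) :
  cd (degcast e x) = degcast e' (cd x).
Proof. by case: n / e' in e *; rewrite (eq_irrelevance e erefl). Qed.

Definition lunit_fun n i j : (i + j)%N = n -> cunit i -> X j -> X n :=
  match i return (i + j)%N = n -> cunit i -> X j -> X n with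
  | 0 => fun e (u : 'rV[rat]_1) x => u ord0 ord0 *: degcast e x
  | _.+1 => fun _ _ _ => 0
  end.

Lemma clunit_subproof n : cbilinear (@lunit_fun n).
Proof.
split=> -[|i] j e z a x y; rewrite /lunit_fun ?scaler0 ?addr0 //.
  by rewrite !mxE scalerDl scalerA.
by rewrite degcast_linear scalerDr !scalerA mulrC.
Qed.

Definition clunit_n n : {linear ctens cunit X n -> X n} :=
  clift (clunit_subproof n).

Lemma clunit_nE n i j (e : (i + j)%N = n) u x :
  clunit_n n (ct e u x) = lunit_fun e u x.
Proof. exact: (cliftE (clunit_subproof n)). Qed.

Lemma cunit0 i (u : cunit i.+1) : u = 0.
Proof. exact: (@thinmx0 rat 1 u). Qed.

Lemma clunit_d n (u : ctens cunit X n.+1) :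
  clunit_n n (cd u) = cd (clunit_n n.+1 u).
Proof.
apply: (@ct_ext _ _ n.+1 _ (clunit_n n \o @cd (ctens cunit X) n)
  (cd \o clunit_n n.+1)) => i j e x y.
rewrite -[LHS]/(clunit_n n (@cd (ctens cunit X) n (ct e x y))).
rewrite -[RHS]/(cd (clunit_n n.+1 (ct e x y))).
case: i e x => [|i] e x; last by rewrite (cunit0 x) ct0l !linear0.
rewrite ctens_cdE dl0 add0r scale1r clunit_nE.
case: j e y => [|j] e y //; rewrite drS clunit_nE /lunit_fun linearZZ.
by rewrite (degcast_d _ (succn_inj e)) -(degcast_irr (succn_inj e)).
Qed.

Definition clunit : chain_map (ctens cunit X) X := ChainMap clunit_d.

Definition cone : cunit 0%N := 1%:M.

Definition cluniti_n n : {linear X n -> ctens cunit X n} :=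
  mklin (@ct_linear_r cunit X n 0%N n erefl cone).

Lemma clunit_nK n : cancel (clunit_n n) (cluniti_n n).
Proof.
apply: (@ct_ext _ _ n _ (cluniti_n n \o clunit_n n) idfun) => i j e u x.
rewrite -[LHS]/(cluniti_n n (clunit_n n (ct e u x))) -[RHS]/(ct e u x).
case: i e u => [|i] e u; last by rewrite (cunit0 u) ct0l !linear0.
rewrite clunit_nE /lunit_fun linearZZ.
rewrite -[X in _ *: X]/(ct _ cone (degcast e x)) -ctZl.
have -> : (u : 'rV[rat]_1) ord0 ord0 *: cone = u.
  by apply/rowP => k; rewrite !mxE !ord1 mulr1.
by case: n / e.
Qed.

Lemma cluniti_nK n : cancel (cluniti_n n) (clunit_n n).
Proof.
move=> x; rewrite -[cluniti_n n x]/(ct _ cone x) clunit_nE /lunit_fun.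
by rewrite mxE scale1r.
Qed.

Lemma cluniti_d n (u : X n.+1) : cluniti_n n (cd u) = cd (cluniti_n n.+1 u).
Proof. by rewrite -{1}[u]cluniti_nK -clunit_d clunit_nK. Qed.

Definition cluniti : chain_map X (ctens cunit X) := ChainMap cluniti_d.

End ChainUnit.

Definition crunit (X : chain) : (ctens X cunit : chain_cat) ~> X :=
  (cbraid X cunit : (ctens X cunit : chain_cat) ~> ctens cunit X) >> clunit X.

Definition cruniti (X : chain) : (X : chain_cat) ~> ctens X cunit :=
  (cluniti X : (X : chain_cat) ~> ctens cunit X) >> cbraid cunit X.

Lemma chain_compE (X Y Z : chain_cat) (f : X ~> Y) (g : Y ~> Z) n (x : X n) :
  (f >> g : chain_map X Z) n x = (g : chain_map Y Z) n ((f : chain_map X Y) n x).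
Proof. by []. Qed.

Lemma chain_idE (X : chain_cat) n (x : X n) : (idm X : chain_map X X) n x = x.
Proof. by []. Qed.

Lemma clunitE (X : chain) n i j (e : (i + j)%N = n) (u : cunit i) (x : X j) :
  clunit X n (ct e u x) = lunit_fun e u x.
Proof. exact: clunit_nE. Qed.

Lemma clunit_nat (X X' : chain) (f : chain_map X X') n i j (e : (i + j)%N = n) u x :
  lunit_fun e u (f j x) = f n (lunit_fun e u x).
Proof.
case: i e u => [|i] e u; rewrite /lunit_fun ?linear0 // linearZZ.
by congr (_ *: _); case: n / e.
Qed.

Lemma cbraidK (X Y : chain) n : cancel (cbraid X Y n) (cbraid Y X n).
Proof.
apply: (@ct_ext _ _ n _ (cbraid Y X n \o cbraid X Y n) idfun) => i j e x y.
rewrite -[LHS]/(cbraid Y X n (cbraid X Y n (ct e x y))) -[RHS]/(ct e x y).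
rewrite (cbraidE e (braid_deg e)) linearZZ (cbraidE _ e) scalerA -exprD mulnC.
by rewrite addnn -signr_odd odd_double scale1r.
Qed.

Lemma cbraid_nat (X X' Y Y' : chain_cat) (f : X ~> X') (g : Y ~> Y') :
  (ctensm f g : (ctens X Y : chain_cat) ~> ctens X' Y') >> cbraid X' Y' =
  (cbraid X Y : (ctens X Y : chain_cat) ~> ctens Y X) >> ctensm g f.
Proof.
apply: chain_map_ext => n; apply: ct_ext => i j e x y.
rewrite !chain_compE ctensmE !(cbraidE e (braid_deg e)).
by rewrite linearZZ ctensmE.
Qed.

Lemma clunit_natm (X X' : chain_cat) (f : X ~> X') :
  (ctensm (idm (cunit : chain_cat)) f :
    (ctens cunit X : chain_cat) ~> ctens cunit X') >> clunit X' =
  (clunit X : (ctens cunit X : chain_cat) ~> X) >> f.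
Proof.
apply: chain_map_ext => n; apply: ct_ext => i j e u x.
by rewrite !chain_compE ctensmE !clunitE chain_idE clunit_nat.
Qed.

Definition chain_symmon : symmoncat.
Proof.
refine (@SymMonCat chain_cat cunit ctens
  (fun X X' Y Y' f g => ctensm f g)
  (fun X Y Z => cassoc X Y Z) (fun X Y Z => cassoci X Y Z)
  (fun X => clunit X) (fun X => cluniti X)
  (fun X => crunit X) (fun X => cruniti X) (fun X Y => cbraid X Y)
  _ _ _ _ _ _ _ _ _ _ _ _ _ _ _ _).
- move=> X Y; apply: chain_map_ext => n; apply: ct_ext => i j e x y.
  by rewrite ctensmE !chain_idE.
- move=> X X' X'' Y Y' Y'' f f' g g'; apply: chain_map_ext => n.
  by apply: ct_ext => i j e x y; rewrite chain_compE !ctensmE !chain_compE.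
- move=> X X' Y Y' Z Z' f g h; apply: chain_map_ext => n.
  apply: ct_ext3 => i l e a b e' x y z.
  rewrite !chain_compE !ctensmE !(cassocE e e' (assoc_deg e e') erefl).
  by rewrite !ctensmE.
- by move=> X Y Z; apply: chain_map_ext => n u; apply: cassoc_nK.
- by move=> X Y Z; apply: chain_map_ext => n u; apply: cassoci_nK.
- exact: clunit_natm.
- by move=> X; apply: chain_map_ext => n u; apply: clunit_nK.
- by move=> X; apply: chain_map_ext => n u; apply: cluniti_nK.
- move=> X X' f; rewrite /crunit [LHS]compA cbraid_nat -compA clunit_natm.
  by rewrite [LHS]compA.
- move=> X; apply: chain_map_ext => n u; rewrite !chain_compE.
  by rewrite [cluniti X n _]clunit_nK cbraidK.
- move=> X; apply: chain_map_ext => n u; rewrite !chain_compE.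
  by rewrite cbraidK [LHS]cluniti_nK.
- exact: cbraid_nat.
- by move=> X Y; apply: chain_map_ext => n u; apply: cbraidK.
- move=> X Y Z T; apply: chain_map_ext => n.
  apply: ct_ext4 => i l e j k e' a b e'' x y z t.
  rewrite !chain_compE ctensmE chain_idE.
  rewrite (cassocE e' e'' (assoc_deg e' e'') erefl).
  rewrite (cassocE e (assoc_deg e' e'') (assoc_deg e (assoc_deg e' e'')) erefl).
  rewrite ctensmE chain_idE.
  rewrite (cassocE erefl erefl (addnA _ _ _) erefl).
  rewrite (cassocE e e' (assoc_deg e e') erefl).
  by rewrite (cassocE (assoc_deg e e') e'' (assoc_deg e (assoc_deg e' e''))
    (addnA b k l)).
- move=> X Y; apply: chain_map_ext => n.
  apply: ct_ext3 => i l e a j e' x u y.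
  rewrite chain_compE !ctensmE !chain_idE.
  rewrite (cassocE e e' (assoc_deg e e') erefl) ctensmE clunitE !chain_idE.
  rewrite !chain_compE (cbraidE e' (braid_deg e')) linearZZ clunitE.
  case: j e' u => [|j] e' u; last by rewrite (cunit0 u) /lunit_fun scaler0 ct0l ct0r.
  rewrite /lunit_fun muln0 scale1r ctZl ctZr; congr (_ *: _).
  move: (braid_deg e') => d; case: i / d in e e' *; exact: ct_irr.
- move=> X Y Z; apply: chain_map_ext => n.
  apply: ct_ext3 => i l e a b e' x y z.
  rewrite !chain_compE ctensmE chain_idE.
  rewrite (cassocE e e' (assoc_deg e e') erefl).
  rewrite (cbraidE _ (braid_deg (assoc_deg e e'))) linearZZ.
  have E : (b + (a + l))%N = n := assoc_deg e (braid_deg e').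
  rewrite (cassocE _ erefl E (addnC l a)).
  rewrite (cbraidE e' (braid_deg e')) ctZl !linearZZ.
  rewrite (cassocE e (braid_deg e') E erefl) ctensmE chain_idE.
  by rewrite (cbraidE _ (addnC l a)) ctZr scalerA -exprD mulnDr.
Defined.

Definition smod : symmoncat := simp_symmon qmod_symmon.

Definition carrier (U : qmod_cat) : type_cat := (U : lmodType rat).

Definition carrier_map (U V : qmod_cat) (f : U ~> V) : carrier U ~> carrier V :=
  (f : {linear U -> V}).

Definition underlying (X : smod) : sset.
Proof.
refine (@Simplicial type_cat (fun n => carrier ((X : simplicial qmod_cat) n))
  (fun m n f => carrier_map (srestr (X : simplicial qmod_cat) f)) _ _).
- by move=> n; rewrite srestr1.
- by move=> m n p f g; rewrite srestrM.
Defined.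

Definition underlying_map (X Y : smod) (f : X ~> Y) :
  underlying X ~> underlying Y.
Proof.
refine (@SimplicialMap type_cat (underlying X) (underlying Y)
  (fun n => carrier_map ((f : simplicial_map X Y) n)) _).
by move=> m n h; have := smap_nat f h => /(congr1 (@carrier_map _ _)).
Defined.

Definition smod_weq : mclass smod := fun X Y f => sset_weq (underlying_map f).
Definition smod_fib : mclass smod :=
  fun X Y f => kan_fibration (underlying_map f).

Definition smod_model : model_data smod :=
  {| weq := smod_weq;
     fib := smod_fib;
     cof := llp (mcap smod_weq smod_fib) |}.

(* Levelwise, Q[X] / Q[P]: the Q-module freely generated by the simplices of X
   outside of the simplicial subset P. *)
Section FreeSmod.
Variables (X : sset) (P : forall n, X n -> Prop).
Hypothesis P_closed :
  forall m n (f : mono m n) (x : X n), P x -> P (srestr X f x).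

Definition free_rel n (r : seq (rat * X n)) : Prop :=
  exists2 x, P x & r = [:: (1, x)].

Definition free_deg n : lmodType rat := presented (@free_rel n).

Lemma free_restr_subproof m n (f : mono m n) :
  respects (@free_rel n)
    (fun x => pgen (@free_rel m) (srestr X f x) : free_deg m).
Proof.
move=> _ [x Px ->]; rewrite /lincomb big_seq1 scale1r /=.
have := @pgen_respects _ (@free_rel m) [:: (1, srestr X f x)].
rewrite /lincomb big_seq1 scale1r; apply.
by exists (srestr X f x) => //; apply: P_closed.
Qed.

Definition free_restr m n (f : mono m n) : {linear free_deg n -> free_deg m} :=
  mklin (pext_linear (free_restr_subproof f)).

Lemma free_restrE m n (f : mono m n) x :
  free_restr f (pgen _ x) = pgen _ (srestr X f x).
Proof. exact: (pext_gen _ (free_restr_subproof f)). Qed.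

Definition free_smod : smod.
Proof.
refine (@Simplicial qmod_cat free_deg free_restr _ _).
- move=> n; apply/lin_ext/pgen_ext => x.
  by rewrite free_restrE srestr1 qmod_idE.
- move=> m n p f g; apply/lin_ext/pgen_ext => x.
  by rewrite qmod_compE !free_restrE srestrM.
Defined.

End FreeSmod.

Definition no_simplex (X : sset) n (x : X n) := False.

Lemma no_simplex_closed (X : sset) m n (f : mono m n) (x : X n) :
  no_simplex x -> no_simplex (srestr X f x).
Proof. by []. Qed.

Definition rat_free (X : sset) : smod := free_smod (@no_simplex_closed X).

Section RatFreeMap.
Variables (X Y : sset) (h : X ~> Y).

Lemma rat_free_map_subproof n :
  respects (@free_rel X (@no_simplex X) n)
    (fun x => pgen _ (h n x) : free_deg (@no_simplex Y) n).
Proof. by move=> r [x []]. Qed.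

Definition rat_free_map_deg n :
    {linear free_deg (@no_simplex X) n -> free_deg (@no_simplex Y) n} :=
  mklin (pext_linear (@rat_free_map_subproof n)).

Lemma rat_free_map_degE n x : rat_free_map_deg n (pgen _ x) = pgen _ (h n x).
Proof. exact: (pext_gen _ (@rat_free_map_subproof n)). Qed.

Definition rat_free_map : rat_free X ~> rat_free Y.
Proof.
refine (@SimplicialMap qmod_cat (rat_free X) (rat_free Y) rat_free_map_deg _).
move=> m n f; apply/lin_ext/pgen_ext => x.
rewrite !qmod_compE [X in rat_free_map_deg _ X]free_restrE !rat_free_map_degE.
rewrite [RHS]free_restrE; congr pgen.
exact: (congr1 (fun k : X n -> Y m => k x) (smap_nat h f)).
Defined.

End RatFreeMap.

Inductive smod_gencof : mclass smod :=
  SmodGencof n : smod_gencof (rat_free_map (bdry_incl n)).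

Record pointed_sset := PointedSset {
  psset :> simplicial type_cat;
  pt : forall n, psset n;
  pt_restr : forall m n (f : mono m n), srestr psset f (pt n) = pt m }.

Definition is_pt (X : pointed_sset) n (x : X n) := x = pt X n.

Lemma is_pt_closed (X : pointed_sset) m n (f : mono m n) (x : X n) :
  is_pt x -> is_pt (srestr X f x).
Proof. by move=> ->; apply: pt_restr. Qed.

Definition rat_reduced (X : pointed_sset) : smod := free_smod (@is_pt_closed X).

(* The quotient X / P, with basepoint the class None of P. *)
Section Quotient.
Variables (X : sset) (P : forall n, X n -> Prop).
Hypothesis P_closed :
  forall m n (f : mono m n) (x : X n), P x -> P (srestr X f x).

Definition quot_deg n := option {x : X n | ~ P x}.

Definition quot_class n (x : X n) : quot_deg n :=
  if pselect (P x) is right nPx then Some (exist _ x nPx) else None.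

Definition quot_restr m n (f : mono m n) (x : quot_deg n) : quot_deg m :=
  if x is Some y then quot_class (srestr X f (sval y)) else None.

Lemma quot_classN n (x : X n) : P x -> quot_class x = None.
Proof. by rewrite /quot_class; case: pselect. Qed.

Lemma quot_class_val n (y : {x : X n | ~ P x}) : quot_class (sval y) = Some y.
Proof.
case: y => x nPx; rewrite /quot_class /=; case: pselect => // nPx'.
by rewrite (Prop_irrelevance nPx nPx').
Qed.

Lemma quot_restr_class m n (f : mono m n) (x : X n) :
  quot_restr f (quot_class x) = quot_class (srestr X f x).
Proof.
by rewrite {1}/quot_class; case: pselect => //= Px; rewrite quot_classN //; apply: P_closed.
Qed.

Definition quot_sset : sset.
Proof.
refine (@Simplicial type_cat quot_deg quot_restr _ _).
- move=> n; apply: funext => -[y|//] /=.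
  by rewrite srestr1 quot_class_val.
- move=> m n p f g; apply: funext => -[y|//] /=.
  by rewrite quot_restr_class srestrM.
Defined.

Definition quot_pointed : pointed_sset :=
  @PointedSset quot_sset (fun n => None) (fun _ _ _ => erefl).

End Quotient.

Definition circle : pointed_sset := quot_pointed (@bdry_closed 1).

Definition rat_circle : smod := rat_reduced circle.

Definition cycle (X : chain) n : X n -> Prop :=
  match n with 0 => fun=> True | _.+1 => fun x => cd x = 0 end.

Definition boundary (X : chain) n (x : X n) := exists y : X n.+1, cd y = x.

(* f is injective and surjective on homology. *)
Definition quasi_iso : mclass chain_cat := fun X Y f => forall n,
  (forall x : X n, cycle x -> boundary (f n x) -> boundary x) /\
  (forall y : Y n, cycle y -> exists2 x : X n, cycle x & boundary (f n x - y)).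

Definition chain_fib : mclass chain_cat := fun X Y f =>
  forall n (y : Y n.+1), exists x, f n.+1 x = y.

Definition chain_model : model_data chain_symmon :=
  {| weq := quasi_iso;
     fib := chain_fib;
     cof := llp (mcap quasi_iso chain_fib) |}.

(* Q in degree n - 1; the zero complex for n = 0. *)
Definition sphere (n : nat) : chain := concentrated (fun k => k.+1 == n).

Definition disk_deg n k : bool := (k == n) || (k.+1 == n).

Definition disk_d n k :
    {linear 'rV[rat]_(disk_deg n k.+1) -> 'rV[rat]_(disk_deg n k)} :=
  mulmxr (pid_mx 1).

Lemma disk_dd n k (x : 'rV[rat]_(disk_deg n k.+2)) :
  disk_d n k (disk_d n k.+1 x) = 0.
Proof.
have : ~~ (disk_deg n k.+2 && disk_deg n k) by rewrite /disk_deg; lia.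
rewrite /disk_d /=; move: (disk_deg n k.+2) (disk_deg n k) x => [] [] //= x _.
- exact: thinmx0.
- by rewrite (thinmx0 x) !mul0mx.
- exact: thinmx0.
Qed.

(* Q in degrees n and n - 1 with differential the identity; Q in degree 0 for
   n = 0. *)
Definition disk n : chain := @Chain (fun k => 'rV[rat]_(disk_deg n k)) (disk_d n)
  (@disk_dd n).

Definition sphere_incl_deg n k :
    {linear 'rV[rat]_(k.+1 == n) -> 'rV[rat]_(disk_deg n k)} :=
  mulmxr (pid_mx 1).

Lemma sphere_incl_d n k (x : sphere n k.+1) :
  sphere_incl_deg n k (@cd (sphere n) k x) =
  @cd (disk n) k (sphere_incl_deg n k.+1 x).
Proof.
rewrite [LHS]linear0 /sphere_incl_deg /= /disk_d /=.
have : ~~ ((k.+2 == n) && disk_deg n k) by rewrite /disk_deg; lia.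
move: x; rewrite /sphere /=; move: (k.+2 == n) (disk_deg n k) => [] [] //= x _.
- by rewrite [RHS]thinmx0.
- by rewrite (thinmx0 x) !mul0mx.
- by rewrite [RHS]thinmx0.
Qed.

Definition sphere_incl n : (sphere n : chain_cat) ~> disk n :=
  @ChainMap (sphere n) (disk n) (sphere_incl_deg n) (@sphere_incl_d n).

Inductive chain_gencof : mclass chain_symmon :=
  ChainGencof n : chain_gencof (sphere_incl n : (sphere n : chain_symmon) ~> disk n).

Definition rat_shift : chain_symmon := concentrated (fun k => k == 1).

(* Main.v *)
From HB Require Import structures.
From mathcomp Require Import all_boot all_fingroup all_algebra.
From mathcomp Require Import boolp.
Require Import Defs.

(** All the model structures compared here have the same weak equivalences, and
their fibrations are determined by these and the cofibrations.  The cofibrations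
in turn are the maps with the left lifting property against a class of levelwise
conditions, so it is enough to show that a G-map that is a naive weak
equivalence is a blended fibration if and only if it is a naive fibration.

A naive acyclic fibration p is a genuine acyclic fibration: since the order of a
subgroup H is invertible, averaging over H projects X equivariantly onto X^H,
which makes p^H a retract of p ([fixed_points_retract]).  So every genuine
cofibration lifts against p, and p is a blended fibration.

Conversely, let p be a blended fibration and j one of a set of maps that detects
fibrations.  Lifting p against j is the same as lifting p equivariantly against
the free G-map G.j, the coproduct of copies of j indexed by G
([free_gmap_lift]).  The map G.j is a genuine cofibration, because a genuine
acyclic fibration is an acyclic fibration after forgetting G.  It remains to see
that it is a weak equivalence.

For chain complexes, j runs over the inclusions of 0 into cones on free graded
modules, whose copowers have the same form.  For simplicial modules, j runs over
the free modules on the horn inclusions.  A horn inclusion is a simplicial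
homotopy equivalence, as both sides contract to the vertex k through the map
i |-> max(i, k) ([horn_homotopy_equiv]), and taking free modules on G-indexed
copies preserves homotopies ([copies_map_weq]).

The two theorems [smod_blended_acyclic_fib] and [chain_blended_acyclic_fib] are
the result for G-objects; the corollary applies them to the symmetric groups. *)

Set Implicit Arguments.
Unset Strict Implicit.
Unset Printing Implicit Defensive.

Import GRing.Theory.

Local Open Scope ring_scope.
Local Open Scope cat_scope.

(** * Retracts, averages and copowers in a category *)

Section Classes.
Variable C : category.

Lemma mclass_ext (P Q : mclass C) :
  (forall a b (f : a ~> b), P a b f <-> Q a b f) -> P = Q.
Proof.
move=> PQ; apply: functional_extensionality_dep => a.
apply: functional_extensionality_dep => b.
by apply: funext => f; apply/propext/PQ.
Qed.

Definition retract_of (a b c d : C) (f : a ~> b) (g : c ~> d) :=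
  exists (i : a ~> c) (r : c ~> a) (j : b ~> d) (s : d ~> b),
  [/\ i >> r = idm a, j >> s = idm b, i >> g = f >> j & r >> f = g >> s].

Definition retract_closed (P : mclass C) :=
  forall (a b c d : C) (f : a ~> b) (g : c ~> d),
  retract_of f g -> P c d g -> P a b f.

Lemma retract_closed_cap (P Q : mclass C) :
  retract_closed P -> retract_closed Q -> retract_closed (mcap P Q).
Proof.
by move=> hP hQ a b c d f g fg [/(hP _ _ _ _ _ _ fg) ? /(hQ _ _ _ _ _ _ fg)].
Qed.

Lemma retract_closed_rlp (P : mclass C) : retract_closed (rlp P).
Proof.
move=> a b c d f g [i [r [j [s [ir js ig rf]]]]] gP x y e Pe u v uv.
have [|h [eh hg]] := gP _ _ _ Pe (u >> i) (v >> j).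
  by rewrite -compA ig !compA uv.
exists (h >> r); rewrite compA eh -compA ir compm1; split=> //.
by rewrite -compA rf compA hg -compA js compm1.
Qed.

(** The part of a Q-linear structure on C that averaging over a subgroup needs:
[avg H F] stands for the mean of the F x for x in H. *)
Record averaging := Averaging {
  avg : forall (gT : finGroupType) (H : {group gT}) (a b : C),
    (gT -> a ~> b) -> a ~> b;
  avg_compl : forall gT (H : {group gT}) a b c (f : a ~> b) (F : gT -> b ~> c),
    f >> avg H F = avg H (fun x => f >> F x);
  avg_compr : forall gT (H : {group gT}) a b c (F : gT -> a ~> b) (f : b ~> c),
    avg H F >> f = avg H (fun x => F x >> f);
  avg_const : forall gT (H : {group gT}) a b (F : gT -> a ~> b) (f : a ~> b),
    (forall x, x \in H -> F x = f) -> avg H F = f;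
  avg_shift : forall gT (H : {group gT}) a b (F : gT -> a ~> b) h,
    h \in H -> avg H (fun x => F (x * h)%g) = avg H F }.

(** The coproduct of I copies of a.  The mediating maps are data, because the
action on a free G-object is defined by one of them. *)
Record copower (I : Type) (a : C) := Copower {
  cpow :> C;
  cpin : I -> a ~> cpow;
  copair : forall b, (I -> a ~> b) -> cpow ~> b;
  copairE : forall b (f : I -> a ~> b) i, cpin i >> copair f = f i;
  copair_ext : forall b (f g : cpow ~> b),
    (forall i, cpin i >> f = cpin i >> g) -> f = g }.

Definition cpmap I (a b : C) (P : copower I a) (Q : copower I b) (f : a ~> b) :
  P ~> Q := copair P (fun i => f >> cpin Q i).

Lemma cpmapE I (a b : C) (P : copower I a) (Q : copower I b) (f : a ~> b) i :
  cpin P i >> cpmap P Q f = f >> cpin Q i.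
Proof. exact: copairE. Qed.

End Classes.

(** * Free G-objects *)

Section FreeGObject.
Variables (C : category) (gT : finGroupType).

Section Object.
Variables (a : C) (P : copower gT a).

(** The action permutes the copies by right multiplication; as composition of
maps is written in diagrammatic order, this is a homomorphism. *)
Definition free_act (g : gT) : P ~> P := copair P (fun x => cpin P (x * g)%g).

Lemma free_actE x g : cpin P x >> free_act g = cpin P (x * g)%g.
Proof. exact: copairE. Qed.

Lemma free_act1 : free_act 1%g = idm P.
Proof. by apply: copair_ext => x; rewrite free_actE mulg1 compm1. Qed.

Lemma free_actM g h : free_act (g * h)%g = free_act g >> free_act h.
Proof. by apply: copair_ext => x; rewrite compA !free_actE mulgA. Qed.

Definition free_gobj : gcat gT C := GObj free_act1 free_actM.

Variables (X : gcat gT C) (u : a ~> gcar X).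

Definition free_ext_fun : P ~> gcar X := copair P (fun x => u >> act X x).

Lemma free_ext_funE x : cpin P x >> free_ext_fun = u >> act X x.
Proof. exact: copairE. Qed.

Lemma free_ext_subproof g :
  act free_gobj g >> free_ext_fun = free_ext_fun >> act X g.
Proof.
apply: copair_ext => x.
by rewrite !compA free_actE !free_ext_funE actM compA.
Qed.

Definition free_ext : free_gobj ~> X := GHom free_ext_subproof.

End Object.

Lemma free_gobj_ext (a : C) (P : copower gT a) (X : gcat gT C)
    (f g : free_gobj P ~> X) :
  cpin P 1%g >> gfun f = cpin P 1%g >> gfun g -> f = g.
Proof.
have translate (h : free_gobj P ~> X) x :
    cpin P x >> gfun h = cpin P 1%g >> gfun h >> act X x.
  by rewrite -compA -(ghomP (h : ghom _ _)) compA /= free_actE mul1g.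
move=> fg; apply: ghom_ext; apply: copair_ext => x.
by rewrite (translate f) (translate g) fg.
Qed.

Lemma free_gmap_subproof (a b : C) (P : copower gT a) (Q : copower gT b)
    (j : a ~> b) g :
  act (free_gobj P) g >> cpmap P Q j = cpmap P Q j >> act (free_gobj Q) g.
Proof.
apply: copair_ext => x.
by rewrite !compA free_actE !cpmapE -compA free_actE.
Qed.

Definition free_gmap (a b : C) (P : copower gT a) (Q : copower gT b)
  (j : a ~> b) : free_gobj P ~> free_gobj Q :=
  @GHom gT C (free_gobj P) (free_gobj Q) (cpmap P Q j) (free_gmap_subproof P Q j).

(** The free G-object functor is left adjoint to forgetting the action, so
lifting problems transpose along it. *)
Lemma free_gmap_lift (a b : C) (P : copower gT a) (Q : copower gT b)
    (j : a ~> b) (X Y : gcat gT C) (p : X ~> Y) :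
  has_lift (free_gmap P Q j) p <-> has_lift j (gfun p).
Proof.
have ext1 (c : C) (R : copower gT c) (Z : gcat gT C) (w : c ~> gcar Z) :
    cpin R 1%g >> gfun (free_ext R w) = w.
  by rewrite /= free_ext_funE act1 compm1.
split=> lift u v uv.
  have [|h [jh hp]] := lift (free_ext P u) (free_ext Q v).
    apply: free_gobj_ext; rewrite [LHS]compA [RHS]compA ext1 cpmapE.
    by rewrite -compA ext1.
  exists (cpin Q 1%g >> gfun h); split.
    by rewrite compA -(cpmapE P) -[u](ext1 _ P) -jh -compA.
  by rewrite -compA -[v](ext1 _ Q) -hp.
have [|h [jh hp]] := lift (cpin P 1%g >> gfun u) (cpin Q 1%g >> gfun v).
  by rewrite -compA -[gfun u >> gfun p]/(gfun (u >> p)) uv !compA -(cpmapE P).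
exists (free_ext Q h); split; apply: free_gobj_ext.
  by rewrite [LHS]compA cpmapE -compA ext1.
by rewrite [LHS]compA ext1.
Qed.

End FreeGObject.

(** * Blended fibrations among naive weak equivalences *)

Section BlendedFibrations.
Variables (C : category) (M : model_data C) (J : mclass C).
Hypothesis avgC : averaging C.
Hypothesis acyclic_retract : retract_closed (acyclic_fib M).
Hypothesis fib_J : forall a b (f : a ~> b), rlp J f -> fib M f.
Hypothesis J_cof : forall a b (j : a ~> b), J j -> llp (acyclic_fib M) j.
Hypothesis J_weq : forall (gT : finGroupType) a b (j : a ~> b), J j ->
  exists (P : copower gT a) (Q : copower gT b), weq M (cpmap P Q j).

Variable gT : finGroupType.

(** The mean of the action over H is an idempotent of X with image X^H, and it is
natural in X. *)
Lemma fixed_points_retract (X Y : gobj gT C) (p : ghom X Y) (H : {group gT})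
    (E F : C) (i : E ~> gcar X) (j : F ~> gcar Y) (pH : E ~> F) :
  fixed_points H i -> fixed_points H j -> pH >> j = i >> gfun p ->
  retract_of pH (gfun p).
Proof.
move=> fpi fpj pHj.
have project (Z : gobj gT C) (D : C) (k : D ~> gcar Z) : fixed_points H k ->
    exists r : gcar Z ~> D, r >> k = avg avgC H (act Z) /\ k >> r = idm D.
  case=> kH kU.
  (* The mean is fixed by H, hence factors through the fixed points. *)
  have [h hH|r [rk _]] := kU _ (avg avgC H (act Z)).
    rewrite avg_compr -[RHS](avg_shift avgC _ hH); congr avg.
    by apply: funext => x; rewrite actM.
  exists r; split=> //; have [s [_ sU]] := kU _ k kH.
  rewrite -(sU (k >> r)) ?(sU (idm D)) ?comp1m //.
  by rewrite -compA rk avg_compl (avg_const _ kH).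
have mono_j (T : C) (f g : T ~> F) : f >> j = g >> j -> f = g.
  case: fpj => jH jU fg; have [h hH|k [_ kU]] := jU _ (g >> j).
    by rewrite -compA jH.
  by rewrite -(kU f fg) (kU g erefl).
have [r [ri ir]] := project _ _ _ fpi; have [s [sj js]] := project _ _ _ fpj.
exists i, r, j, s; split=> //; apply: mono_j.
rewrite -!compA pHj sj compA ri avg_compr avg_compl; congr avg.
by apply: funext => x; rewrite ghomP.
Qed.

Lemma acyclic_fib_genuine (X Y : gcat gT C) (p : X ~> Y) :
  acyclic_fib M (gfun p) -> genuine_acyclic_fib M p.
Proof.
move=> pM H E F i j pH fpi fpj pHj.
exact: acyclic_retract (fixed_points_retract fpi fpj pHj) pM.
Qed.

(** The identity of X exhibits X as its own fixed points under the trivial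
subgroup. *)
Lemma genuine_acyclic_fib_underlying (X Y : gcat gT C) (p : X ~> Y) :
  genuine_acyclic_fib M p -> acyclic_fib M (gfun p).
Proof.
have fp (Z : gcat gT C) : fixed_points [1 gT]%G (idm (gcar Z)).
  split=> [h /set1P->|T f _]; first by rewrite act1 compm1.
  by exists f; split=> [|g]; rewrite compm1.
by apply; [exact: fp | exact: fp | rewrite compm1 comp1m].
Qed.

(** Left to right, p lifts against the free G-maps on J, which are genuine
cofibrations and naive weak equivalences.  Right to left, p is a genuine acyclic
fibration. *)
Theorem blended_acyclic_fib (X Y : gcat gT C) (p : X ~> Y) :
  naive_weq M p /\ blended_fib M p <-> naive_weq M p /\ naive_fib M p.
Proof.
split=> -[pw pf]; split=> //; last first.
  by move=> a b f [_ fc]; apply/fc/acyclic_fib_genuine.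
apply: fib_J => a b j Jj.
have [P [Q jw]] := J_weq gT Jj.
apply/(free_gmap_lift P Q)/pf; split=> // c d q qg.
by apply/free_gmap_lift/J_cof => //; apply: genuine_acyclic_fib_underlying.
Qed.

End BlendedFibrations.

(** * From G-objects to symmetric spectra *)

Section Spectra.
Variables (C : symmoncat) (K : C) (M : model_data C) (gencof : mclass C).
Hypothesis blendedE : forall n (X Y : gcat 'S_n C) (p : X ~> Y),
  naive_weq M p /\ blended_fib M p <-> naive_weq M p /\ naive_fib M p.

Lemma flat_stable_model : flat_model K M gencof = stable_model K M gencof.
Proof.
rewrite /flat_model (_ : (fun X Y f => _) =
  mcap (level_weq (K := K) M) (level_fib (K := K) M)) //.
apply: mclass_ext => X Y f; split=> [h|[hw hf] n]; last exact/blendedE.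
by split=> n; have [] := (blendedE (spmap f n)).1 (h n).
Qed.

Lemma positive_flat_stable_model :
  positive_flat_model K M gencof = positive_stable_model K M gencof.
Proof.
congr (model_of_cof _ _ (llp _)); apply: mclass_ext => X Y f.
by split=> h n n_gt0; apply/blendedE/h.
Qed.

End Spectra.

(** * Averages of linear maps *)

Section QmodAverage.
Variables (gT : finGroupType) (H : {group gT}) (U V : lmodType rat).
Variable F : gT -> {linear U -> V}.

Definition qavg_fun (u : U) : V := #|H|%:R^-1 *: \sum_(x in H) F x u.

Lemma qavg_subproof : linear qavg_fun.
Proof.
move=> a u v; rewrite /qavg_fun scalerA mulrC -scalerA -scalerDr; congr (_ *: _).
by rewrite scaler_sumr -big_split; apply: eq_bigr => x _; rewrite linearP.
Qed.

Definition qavg : {linear U -> V} := mklin qavg_subproof.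

Lemma qavg_eq u v : (forall x, x \in H -> F x u = v) -> qavg u = v.
Proof.
move=> Fu; rewrite /= /qavg_fun (eq_bigr (fun=> v)) //.
rewrite big_const iter_addr addr0 -scaler_nat scalerA mulVf ?scale1r //.
by rewrite Num.Theory.pnatr_eq0 -lt0n cardG_gt0.
Qed.

End QmodAverage.

Lemma qavg_mul (gT : finGroupType) (H : {group gT}) (U V : lmodType rat)
    (F : gT -> {linear U -> V}) h u :
  h \in H -> qavg H (fun x => F (x * h)%g) u = qavg H F u.
Proof.
move=> hH; congr (_ *: _); rewrite [RHS](reindex_inj (mulIg h)).
by apply: eq_bigl => x; rewrite groupMr.
Qed.

Lemma linear_qavg (gT : finGroupType) (H : {group gT}) (U V W : lmodType rat)
    (F : gT -> {linear U -> V}) (f : {linear V -> W}) u :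
  f (qavg H F u) = qavg H (fun x => f \o F x) u.
Proof. by rewrite /= /qavg_fun linearZZ linear_sum. Qed.

Definition qmod_averaging : averaging qmod_cat.
Proof.
refine (@Averaging qmod_cat qavg _ _ _ _).
- by move=> *; apply: lin_ext.
- by move=> *; apply: lin_ext => u; apply: linear_qavg.
- by move=> gT H U V F f Ff; apply: lin_ext => u; apply: qavg_eq => x /Ff->.
- by move=> *; apply: lin_ext => u; apply: qavg_mul.
Defined.

Section SimplicialAveraging.
Variables (C : category) (avgC : averaging C).

Lemma simp_avg_subproof (gT : finGroupType) (H : {group gT}) (X Y : simp_cat C)
    (F : gT -> simplicial_map X Y) m n (h : mono m n) :
  srestr X h >> avg avgC H (fun g => F g m) =
  avg avgC H (fun g => F g n) >> srestr Y h.
Proof.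
rewrite avg_compl avg_compr; congr avg; apply: funext => g; exact: smap_nat.
Qed.

Definition simp_averaging : averaging (simp_cat C).
Proof.
refine (@Averaging (simp_cat C)
  (fun gT H X Y F => SimplicialMap (simp_avg_subproof H F)) _ _ _ _).
- by move=> *; apply: smap_ext => n; apply: avg_compl.
- by move=> *; apply: smap_ext => n; apply: avg_compr.
- move=> gT H X Y F f Ff; apply: smap_ext => n.
  by apply: avg_const => x xH; rewrite Ff.
- move=> gT H X Y F h hH; apply: smap_ext => n.
  exact: (avg_shift avgC (fun g => (F g : simplicial_map X Y) n)).
Defined.

End SimplicialAveraging.

(** * Chain complexes *)

Section FreeQmod.
Variable T : Type.

Definition free_qmod : lmodType rat := presented (fun _ : seq (rat * T) => False).

Definition qgen (t : T) : free_qmod := pgen _ t.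

Variables (V : lmodType rat) (f : T -> V).

Lemma free_qmod_subproof : respects (fun=> False) f. Proof. by []. Qed.

Definition qext : {linear free_qmod -> V} :=
  mklin (pext_linear free_qmod_subproof).

Lemma qextE t : qext (qgen t) = f t.
Proof. exact: (pext_gen _ free_qmod_subproof). Qed.

End FreeQmod.

Lemma chain_avg_subproof (gT : finGroupType) (H : {group gT}) (X Y : chain)
    (F : gT -> chain_map X Y) n (x : X n.+1) :
  qavg H (fun g => F g n) (cd x) = cd (qavg H (fun g => F g n.+1) x).
Proof.
by rewrite linear_qavg; congr (_ *: _); apply: eq_bigr => g _; rewrite cfun_d.
Qed.

Definition chain_averaging : averaging chain_cat.
Proof.
refine (@Averaging chain_cat (fun gT H X Y F => ChainMap (chain_avg_subproof H F))
  _ _ _ _).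
- by move=> *; apply: chain_map_ext.
- by move=> *; apply: chain_map_ext => n u; apply: linear_qavg.
- by move=> gT H X Y F f Ff; apply: chain_map_ext => n u; apply: qavg_eq => x /Ff->.
- move=> gT H X Y F h hH; apply: chain_map_ext => n u.
  exact: (qavg_mul (fun g => (F g : chain_map X Y) n)).
Defined.

(** The cone on the graded module that is free on S k in degree k.+1: a chain
complex with zero homology that is free as such on the family of sets S.  Its
degree k part is V k * V k.+1, where V is the graded module, with the generators
in the first factor and their boundaries in the second. *)
Section FreeCone.
Variable S : nat -> Type.

(** Nothing is generated in degree 0, where a generator would be a cycle that
does not bound. *)
Definition cone_gen (k : nat) : lmodType rat :=
  if k is k'.+1 then free_qmod (S k') else 'rV[rat]_0.

Lemma cone_gen0 (x : cone_gen 0) : x = 0.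
Proof. exact: thinmx0. Qed.

Definition cone_deg (k : nat) : lmodType rat := (cone_gen k * cone_gen k.+1)%type.

Lemma cone_d_subproof k : linear (fun x : cone_deg k.+1 => (0, x.1) : cone_deg k).
Proof. by move=> a x y; congr pair => /=; rewrite scaler0 addr0. Qed.

Definition cone_d k : {linear cone_deg k.+1 -> cone_deg k} :=
  mklin (@cone_d_subproof k).

Lemma cone_dd k (x : cone_deg k.+2) : cone_d k (cone_d k.+1 x) = 0.
Proof. by []. Qed.

Definition free_cone : chain := Chain cone_dd.

Definition cone_pt k (s : S k) : free_cone k.+1 := (qgen s, 0).

Section Lift.
Variables (Y : chain) (f : forall k, S k -> Y k.+1).

Definition cone_gen_ext k : {linear cone_gen k -> Y k} :=
  match k with
  | 0 => \0
  | k'.+1 => qext (@f k')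
  end.

Lemma cone_ext_subproof1 k :
  linear (fun x : free_cone k => cone_gen_ext k x.1 + cd (cone_gen_ext k.+1 x.2)).
Proof.
move=> a x y; rewrite linearP [(a *: x + y).2]/= !linearP /=.
by rewrite scalerDr -!addrA; congr (_ + _); rewrite addrCA.
Qed.

Lemma cone_ext_subproof2 k (x : free_cone k.+1) :
  mklin (@cone_ext_subproof1 k) (cd x) = cd (mklin (@cone_ext_subproof1 k.+1) x).
Proof. by rewrite /= linear0 add0r linearD cdd addr0. Qed.

Definition cone_ext : chain_map free_cone Y := ChainMap cone_ext_subproof2.

Lemma cone_extE k (s : S k) : cone_ext k.+1 (cone_pt s) = f s.
Proof.
rewrite -[LHS]/(qext (@f k) (qgen s) + cd (qext (@f k.+1) 0)).
by rewrite qextE !linear0 addr0.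
Qed.

End Lift.

(** The element (x, y) is (x, 0) plus the boundary of (y, 0), and the elements
(x, 0) are combinations of generators. *)
Lemma cone_map_ext (Y : chain) (f g : chain_map free_cone Y) :
  (forall k (s : S k), f k.+1 (cone_pt s) = g k.+1 (cone_pt s)) -> f = g.
Proof.
move=> fg; have fg1 k (x : cone_gen k) : f k (x, 0) = g k (x, 0).
  case: k x => [|k] x; first by rewrite (cone_gen0 x) !linear0.
  have ll : linear (fun x => (x, 0) : free_cone k.+1).
    by move=> a u v; congr pair; rewrite /= scaler0 addr0.
  apply: (pgen_ext (f := f k.+1 \o mklin ll) (g := g k.+1 \o mklin ll)) => s.
  exact: fg.
apply: chain_map_ext => k -[x y].
have -> : (x, y) = (x, 0) + cd ((y, 0) : free_cone k.+1) :> free_cone k.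
  by congr pair; rewrite ?addr0 ?add0r.
by rewrite !linearD !cfun_d !fg1.
Qed.

Lemma free_cone_acyclic n (x : free_cone n) : cycle x -> boundary x.
Proof.
move=> xZ; exists ((x.2, 0) : free_cone n.+1); rewrite [RHS]surjective_pairing.
congr pair; case: n x xZ => [|n] x; first by rewrite [RHS]cone_gen0.
by move/(congr1 snd).
Qed.

End FreeCone.

Lemma acyclic_quasi_iso (X Y : chain_cat) (f : X ~> Y) :
  (forall n (x : (X : chain) n), cycle x -> boundary x) ->
  (forall n (y : (Y : chain) n), cycle y -> boundary y) -> quasi_iso f.
Proof.
move=> hX hY n; split=> [x xZ _|y yZ]; first exact: hX.
exists 0; first by case: n {y yZ} => //= n; rewrite linear0.
by have [z zy] := hY _ _ yZ; exists (- z); rewrite linearN zy linear0 add0r.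
Qed.

Definition cone_copower I (S : nat -> Type) :
  copower (C := chain_cat) I (free_cone S).
Proof.
refine (@Copower chain_cat I (free_cone S) (free_cone (fun k => I * S k)%type)
  (fun i => cone_ext (fun k s => @cone_pt (fun k => I * S k)%type k (i, s)))
  (fun Y f => cone_ext (fun k t => (f t.1 : chain_map _ _) k.+1 (cone_pt t.2)))
  _ _).
- by move=> Y f i; apply: cone_map_ext => k s; rewrite chain_compE !cone_extE.
- move=> Y f g fg; apply: cone_map_ext => k [i s].
  have /(congr1 (fun h : chain_map _ _ => h k.+1 (cone_pt s))) := fg i.
  by rewrite !chain_compE !cone_extE.
Defined.

(** The cone on no generators is the initial chain complex. *)
Definition no_gen (k : nat) := void.

Definition zero_cone_map (S : nat -> Type) :
    (free_cone no_gen : chain_cat) ~> free_cone S :=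
  cone_ext (fun k (s : no_gen k) => match s with end).

Inductive zero_to_cone : mclass chain_cat :=
  ZeroToCone S : zero_to_cone (zero_cone_map S).

(** A map from a cone is the choice of an element of Y k.+1 for each s in S k, so
lifting these maps is lifting elements of positive degree. *)
Lemma zero_to_cone_lift (X Y : chain_cat) (p : X ~> Y) :
  rlp zero_to_cone p <-> chain_fib p.
Proof.
split=> [pJ n y|pf _ _ _ [S] u v _].
  (* The cone on all elements of positive degree of Y. *)
  pose S k := (Y : chain) k.+1; pose v := cone_ext (fun k (s : S k) => s).
  pose u := cone_ext (Y := X) (fun k (s : no_gen k) => match s with end).
  have [|h [_ hp]] := pJ _ _ _ (ZeroToCone S) u v; first exact: cone_map_ext.
  exists ((h : chain_map _ _) n.+1 (@cone_pt S n y)).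
  by rewrite -chain_compE hp cone_extE.
pose g k s := sval (cid (pf k ((v : chain_map _ _) k.+1 (@cone_pt S k s)))).
exists (cone_ext g); split; first exact: cone_map_ext.
apply: cone_map_ext => k s; rewrite chain_compE cone_extE.
exact: (svalP (cid (pf k _))).
Qed.

Lemma quasi_iso_retract : retract_closed quasi_iso.
Proof.
move=> A B X Y f g [i [r [j [s [ir js ig rf]]]]] gq n.
have app (U V W : chain_cat) (u : U ~> V) (w : V ~> W) t m (x : (U : chain) m) :
    u >> w = t -> (w : chain_map _ _) m ((u : chain_map _ _) m x) =
      (t : chain_map _ _) m x by move=> <-.
have map_cycle (U V : chain) (u : chain_map U V) m (x : U m) :
    cycle x -> cycle (u m x).
  by case: m x => //= m x xZ; rewrite -cfun_d xZ linear0.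
have map_boundary (U V : chain) (u : chain_map U V) m (x : U m) :
    boundary x -> boundary (u m x).
  by case=> y <-; exists (u m.+1 y); rewrite cfun_d.
have [gi gs] := gq n; split=> [x xZ fxB|y yZ].
  rewrite -[x]chain_idE -(app _ _ _ _ _ _ _ _ ir); apply/map_boundary/gi.
    exact: map_cycle.
  by rewrite (app _ _ _ _ _ _ _ _ ig) chain_compE; apply: map_boundary.
have [x xZ xB] := gs _ (map_cycle _ _ j _ _ yZ).
exists ((r : chain_map _ _) n x); first exact: map_cycle.
have /(map_boundary _ _ s) := xB.
by rewrite linearB (app _ _ _ _ _ _ _ _ js) (app _ _ _ _ _ _ _ _ (esym rf)).
Qed.

Theorem chain_blended_acyclic_fib (gT : finGroupType) (X Y : gcat gT chain_symmon)
    (p : X ~> Y) :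
  naive_weq chain_model p /\ blended_fib chain_model p <->
  naive_weq chain_model p /\ naive_fib chain_model p.
Proof.
apply: (blended_acyclic_fib (M := chain_model) (J := zero_to_cone) chain_averaging).
- apply: retract_closed_cap; first exact: quasi_iso_retract.
  move=> A B C D f g fg /zero_to_cone_lift gJ; apply/zero_to_cone_lift.
  exact: retract_closed_rlp fg gJ.
- by move=> A B f /zero_to_cone_lift.
- by move=> A B j Jj X' Y' q [_ /zero_to_cone_lift]; apply.
- move=> G A B _ [S]; exists (cone_copower G no_gen), (cone_copower G S).
  by apply: acyclic_quasi_iso; apply: free_cone_acyclic.
Qed.

(** * Simplicial homotopy equivalences *)

Section Homotopy.

Lemma sset_mapP (X Y : sset) (f : X ~> Y) m n (h : mono m n) (x : X n) :
  (f : simplicial_map X Y) m (srestr X h x) = srestr Y h (f n x).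
Proof. exact: (congr1 (fun k : X n -> Y m => k x) (smap_nat f h)). Qed.

Lemma sset_map_ext (X Y : sset) (f g : X ~> Y) :
  (forall n x, f n x = g n x) -> f = g.
Proof. by move=> fg; apply: smap_ext => n; apply: funext => x. Qed.

Lemma sset_eqE (X Y : sset) (f g : X ~> Y) n x : f = g -> f n x = g n x.
Proof. by move=> ->. Qed.

Section SsetMap.
Variables (X Y : sset) (f : forall n, X n -> Y n).
Hypothesis f_nat :
  forall m n (h : mono m n) x, f (srestr X h x) = srestr Y h (f x).

Definition sset_map : X ~> Y :=
  @SimplicialMap type_cat X Y f (fun m n h => funext (f_nat h)).

End SsetMap.

Lemma elem_homotopic_comp (X Y Z T : sset) (e : X ~> Y) (f g : Y ~> Z) (k : Z ~> T) :
  elem_homotopic f g -> elem_homotopic (e >> f >> k) (e >> g >> k).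
Proof.
case=> h hE.
unshelve eexists (@sset_map (sprod X (std_simplex 1)) T
    (fun n y => k n (h n (e n y.1, y.2))) _) => [m n t [x s]|m x] /=.
  rewrite (sset_mapP e) -(sset_mapP k); congr (k m _).
  exact: (sset_mapP h t (e n x, s)).
by have [-> ->] := hE m (e m x).
Qed.

Lemma homotopic_comp (X Y Z T : sset) (e : X ~> Y) (f g : Y ~> Z) (k : Z ~> T) :
  homotopic f g -> homotopic (e >> f >> k) (e >> g >> k).
Proof.
move=> fg; move: e k; elim: f g / fg => [f g fg|f|f g _ IH|f g h _ IH1 _ IH2] e k.
- by apply/htp_elem/elem_homotopic_comp.
- exact: htp_refl.
- exact/htp_sym/IH.
- exact: htp_trans (IH1 e k) (IH2 e k).
Qed.

Lemma homotopic_pre (X Y Z : sset) (e : X ~> Y) (f g : Y ~> Z) :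
  homotopic f g -> homotopic (e >> f) (e >> g).
Proof. by move/(homotopic_comp e (idm Z)); rewrite !compm1. Qed.

Lemma homotopic_post (X Y Z : sset) (f g : X ~> Y) (k : Y ~> Z) :
  homotopic f g -> homotopic (f >> k) (g >> k).
Proof. by move/(homotopic_comp (idm X) k); rewrite !comp1m. Qed.

Definition homotopy_equiv (X Y : sset) (f : X ~> Y) :=
  exists g : Y ~> X, homotopic (f >> g) (idm X) /\ homotopic (g >> f) (idm Y).

(** A homotopy inverse induces an inverse on homotopy classes of maps into any
simplicial set. *)
Lemma homotopy_equiv_weq (X Y : sset) (f : X ~> Y) : homotopy_equiv f -> sset_weq f.
Proof.
case=> g [fg gf] Z _; split=> [u|v w fvw].
  by exists (g >> u); rewrite compA -[X in homotopic _ X]comp1m;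
    apply: homotopic_post.
have gfE (t : Y ~> Z) : homotopic (g >> (f >> t)) t.
  by rewrite compA -[X in homotopic _ X]comp1m;
    apply: homotopic_post.
apply: (htp_trans (htp_sym (gfE v))); apply: htp_trans (gfE w).
exact: homotopic_pre.
Qed.

Lemma sset_weq_retract : retract_closed sset_weq.
Proof.
move=> A B X Y f g [i [r [j [s [ir js ig rf]]]]] gw Z kZ.
have [gs gi] := gw Z kZ; split=> [u|v w fvw].
  have [v gv] := gs (r >> u); exists (j >> v).
  by rewrite compA -ig -compA -[u]comp1m -ir -compA; apply: homotopic_pre.
rewrite -[v]comp1m -[w]comp1m -js -!compA; apply/homotopic_pre/gi.
by rewrite !compA -rf -!compA; apply: homotopic_pre.
Qed.

End Homotopy.

Lemma const_monoE m (j : 'I_2) i : (const_mono m j : mono m 1) i = j.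
Proof. by rewrite /mono_fun /= ffunE. Qed.

(** * Horns are contractible *)

(** Monotone self-maps phi <= psi of the vertices of a simplex form a monotone
map on the product of the vertices with {0, 1}, that is, a homotopy. *)
Section Slide.
Variables (N : nat) (phi psi : 'I_N.+1 -> 'I_N.+1).
Hypothesis phi_mono : {homo phi : i j / (i <= j)%N}.
Hypothesis psi_mono : {homo psi : i j / (i <= j)%N}.
Hypothesis phi_psi : forall i, (phi i <= psi i)%N.

Definition slide_fun (i : 'I_N.+1) (t : 'I_2) := if t == 0 then phi i else psi i.

Lemma slide_subproof m (f : mono m N) (t : mono m 1) :
  monotone [ffun i => slide_fun (f i) (t i)].
Proof.
apply/forallP => i; apply/forallP => j; apply/implyP => ij; rewrite !ffunE.
have fij := monoP f ij; have := monoP t ij; rewrite /slide_fun.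
case: eqP => [_ _|ti]; case: eqP => [tj|_] //=.
- exact: phi_mono.
- exact: leq_trans (phi_psi _) (psi_mono fij).
- by rewrite tj leqn0 => /eqP ti0; case: ti; apply: val_inj.
- by move=> _; apply: psi_mono.
Qed.

Definition slide m (f : mono m N) (t : mono m 1) : mono m N :=
  Sub _ (slide_subproof f t).

Lemma slideE m (f : mono m N) (t : mono m 1) i :
  slide f t i = slide_fun (f i) (t i).
Proof. by rewrite {1}/mono_fun /= ffunE. Qed.

Variable P : forall m, std_simplex N m -> Prop.
Hypothesis P_closed : forall m n (f : mono m n) (x : std_simplex N n),
  P x -> P (srestr (std_simplex N) f x).
Hypothesis P_slide : forall m (f : mono m N) (t : mono m 1),
  P (f : std_simplex N m) -> P (slide f t : std_simplex N m).

Definition slide_sub m (x : {f : std_simplex N m | P f} * mono m 1) :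
    {f : std_simplex N m | P f} :=
  exist _ (slide (sval x.1) x.2) (P_slide x.2 (svalP x.1)).

Lemma slide_homotopic (f g : sub_sset P_closed ~> sub_sset P_closed) :
  (forall m (x : sub_sset P_closed m) i,
    (sval (f m x) : mono m N) i = phi ((sval x : mono m N) i)) ->
  (forall m (x : sub_sset P_closed m) i,
    (sval (g m x) : mono m N) i = psi ((sval x : mono m N) i)) ->
  homotopic f g.
Proof.
move=> fE gE; apply: htp_elem.
unshelve eexists (@sset_map (sprod (sub_sset P_closed) (std_simplex 1))
    (sub_sset P_closed) slide_sub _) => [m n h [[x Px] t]|m x].
  apply: sub_sset_ext; apply: mono_ext => i.
  by rewrite /= slideE !mono_compE slideE.
by split; apply: sub_sset_ext; apply: mono_ext => i;
  rewrite ?fE ?gE [LHS]slideE const_monoE.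
Qed.

End Slide.

Section HornContraction.
Variables (n : nat) (k : 'I_n.+2).

Let N := n.+1.

Definition vertex_subproof m : monotone [ffun _ : 'I_m.+1 => k].
Proof. by do 2!apply/forallP => ?; rewrite !ffunE leqnn implybT. Qed.

Definition vertex m : mono m N := Sub _ (vertex_subproof m).

Lemma vertexE m i : vertex m i = k.
Proof. by rewrite /mono_fun /= ffunE. Qed.

(** A simplicial subset of the simplex contracts to the vertex k if adjoining k to
the vertices of its simplices does not lead out of it: both the identity and the
constant map k are below i |-> max(i, k). *)
Section Coned.
Variable P : forall m, std_simplex N m -> Prop.
Hypothesis P_closed : forall m n (f : mono m n) (x : std_simplex N n),
  P x -> P (srestr (std_simplex N) f x).
Hypothesis P_cone : forall m (x y : mono m N), P (x : std_simplex N m) ->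
  (forall i, y i = x i \/ y i = k) -> P (y : std_simplex N m).

Lemma cone_contract (c : sub_sset P_closed ~> sub_sset P_closed) :
  (forall m (x : sub_sset P_closed m), sval (c m x) = vertex m) ->
  homotopic c (idm _).
Proof.
move=> cE; pose up (i : 'I_N.+1) : 'I_N.+1 := if (i <= k)%N then k else i.
have up_mono : {homo up : i j / (i <= j)%N}.
  rewrite /up => i j ij; case: (leqP i k) => ik; case: (leqP j k) => jk //.
    exact: ltnW.
  exact: leq_trans jk.
have id_up (i : 'I_N.+1) : (i <= up i)%N by rewrite /up; case: (leqP i k).
have k_up (i : 'I_N.+1) : (k <= up i)%N by rewrite /up; case: (leqP i k) => // /ltnW.
have upE i : up i = i \/ up i = k by rewrite /up; case: ifP; [right | left].
have P_id m (f : mono m N) (t : mono m 1) : P (f : std_simplex N m) ->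
    P (slide (phi := id) (fun _ _ => id) up_mono id_up f t : std_simplex N m).
  move/P_cone; apply=> i; rewrite slideE /slide_fun.
  by case: eqP => _; [left | apply: upE].
have P_k m (f : mono m N) (t : mono m 1) : P (f : std_simplex N m) ->
    P (slide (phi := fun=> k) (fun _ _ _ => leqnn k) up_mono k_up f t :
      std_simplex N m).
  move/P_cone; apply=> i; rewrite slideE /slide_fun.
  by case: eqP => _; [right | apply: upE].
pose top m (x : sub_sset P_closed m) : sub_sset P_closed m :=
  slide_sub P_id (x, const_mono m 1).
have topE m (x : sub_sset P_closed m) i :
    (sval (top m x) : mono m N) i = up ((sval x : mono m N) i).
  by rewrite slideE const_monoE.
have top_nat m p (h : mono m p) (x : sub_sset P_closed p) :
    top m (srestr (sub_sset P_closed) h x) = srestr (sub_sset P_closed) h (top p x).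
  by apply: sub_sset_ext; apply: mono_ext => i; rewrite topE !mono_compE topE.
apply: (@htp_trans _ _ _ (sset_map top_nat)).
  by apply: (slide_homotopic P_k) => m x i; rewrite ?topE // cE vertexE.
by apply/htp_sym/(slide_homotopic P_id) => m x i; rewrite ?topE.
Qed.

End Coned.

(** The homotopy inverse is constant at the vertex k.  Each composite is constant
at k, on the horn and on the simplex, and [cone_contract] applies to both: a horn
consists of the simplices that miss some vertex other than k. *)
Lemma horn_homotopy_equiv : homotopy_equiv (horn_incl k).
Proof.
have vertex_horn m : horn_pred k (vertex m : std_simplex N m).
  exists (lift k ord0) => [|i]; first by rewrite eq_sym neq_lift.
  by rewrite vertexE neq_lift.
have vertex_nat m p (h : mono m p) : mono_comp h (vertex p) = vertex m.
  by apply: mono_ext => i; rewrite mono_compE !vertexE.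
unshelve eexists (@sset_map (std_simplex N) (sub_sset (@horn_closed N k))
    (fun m _ => exist _ (vertex m) (vertex_horn m)) _) => [m p h x|].
  by apply: sub_sset_ext; rewrite /= vertex_nat.
split.
  apply: cone_contract => // m x y [j jk jx] xy.
  by exists j => // i; case: (xy i) => ->; rewrite ?jx // eq_sym.
(* The simplex is the simplicial subset of itself given by the predicate True. *)
pose all m (x : std_simplex N m) := True.
pose all_closed m p (h : mono m p) x (t : all p x) : all m (mono_comp h x) := t.
have into_nat m p (h : mono m p) (x : std_simplex N p) :
    exist (all m) (srestr (std_simplex N) h x) I =
    srestr (sub_sset all_closed) h (exist (all p) x I) by exact: sub_sset_ext.
pose into : std_simplex N ~> sub_sset all_closed :=
  @sset_map (std_simplex N) (sub_sset all_closed) (fun m x => exist (all m) x I)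
    into_nat.
set c := (_ >> horn_incl k).
have <- : into >> (sub_incl all_closed >> c >> into) >> sub_incl all_closed = c.
  exact: smap_ext.
have -> : idm (std_simplex N) = into >> idm _ >> sub_incl all_closed.
  exact: smap_ext.
by apply: homotopic_comp; apply: cone_contract.
Qed.

End HornContraction.

(** * Free simplicial modules *)

Definition smod_deg (Y : smod) n : lmodType rat := (Y : simplicial qmod_cat) n.

Definition smod_fun (X Y : smod) (f : X ~> Y) n :
    {linear smod_deg X n -> smod_deg Y n} :=
  (f : simplicial_map X Y) n.

Lemma smod_mapP (X Y : smod) (f : X ~> Y) m n (h : mono m n)
    (x : underlying X n) :
  smod_fun f m (srestr (underlying X) h x) =
  srestr (underlying Y) h (smod_fun f n x).
Proof. exact: (sset_mapP (underlying_map f)). Qed.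

Definition simplex (X : sset) n (x : X n) : underlying (rat_free X) n :=
  pgen (free_rel (@no_simplex X) (n := n)) x.

Lemma smod_map_ext (X : sset) (Y : smod) (f g : rat_free X ~> Y) :
  (forall n (x : X n), smod_fun f n (simplex x) = smod_fun g n (simplex x)) -> f = g.
Proof. by move=> fg; apply: smap_ext => n; apply/lin_ext/pgen_ext/fg. Qed.

Lemma simplex_restr (X : sset) m n (h : mono m n) (x : X n) :
  srestr (underlying (rat_free X)) h (simplex x) = simplex (srestr X h x).
Proof. exact: (free_restrE (@no_simplex_closed X)). Qed.

Section Extend.
Variables (X : sset) (Y : smod) (u : X ~> underlying Y).

Lemma simplex_respects n (V : lmodType rat) (f : X n -> V) :
  respects (free_rel (@no_simplex X) (n := n)) f.
Proof. by move=> r [x []]. Qed.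

Definition rat_free_ext_deg n : {linear smod_deg (rat_free X) n -> smod_deg Y n} :=
  mklin (pext_linear (simplex_respects (u n : X n -> smod_deg Y n))).

Lemma rat_free_ext_degE n (x : X n) : rat_free_ext_deg n (simplex x) = u n x.
Proof. exact: (pext_gen _ (simplex_respects (u n : X n -> smod_deg Y n))). Qed.

Definition rat_free_ext : rat_free X ~> Y.
Proof.
refine (@SimplicialMap qmod_cat (rat_free X) Y rat_free_ext_deg _).
move=> m n h; apply/lin_ext/pgen_ext => x; rewrite !qmod_compE.
rewrite [X in rat_free_ext_deg _ X]simplex_restr !rat_free_ext_degE.
exact: (sset_mapP u).
Defined.

Lemma rat_free_extE n (x : X n) : smod_fun rat_free_ext n (simplex x) = u n x.
Proof. exact: rat_free_ext_degE. Qed.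

End Extend.

Lemma smod_compE (X Y Z : smod) (f : X ~> Y) (g : Y ~> Z) n x :
  smod_fun (f >> g) n x = smod_fun g n (smod_fun f n x).
Proof. by []. Qed.

Lemma rat_free_mapE (X Y : sset) (h : X ~> Y) n (x : X n) :
  smod_fun (rat_free_map h) n (simplex x) = simplex (h n x).
Proof. exact: rat_free_map_degE. Qed.

Definition rat_free_unit (X : sset) : X ~> underlying (rat_free X) :=
  @sset_map X (underlying (rat_free X)) (fun n x => simplex x)
    (fun m n h x => esym (simplex_restr h x)).

(** The free module functor is left adjoint to [underlying], so lifting problems
transpose along it. *)
Lemma rat_free_lift (A B : sset) (j : A ~> B) (X Y : smod) (p : X ~> Y) :
  has_lift (rat_free_map j) p <-> has_lift j (underlying_map p).
Proof.
split=> lift u v uv.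
  have [|h [jh hp]] := lift (rat_free_ext u) (rat_free_ext v).
    apply: smod_map_ext => n x; rewrite !smod_compE rat_free_mapE !rat_free_extE.
    exact: sset_eqE uv.
  exists (rat_free_unit B >> underlying_map h); split; apply: sset_map_ext => n x.
    by rewrite -(rat_free_extE u) -jh smod_compE rat_free_mapE.
  by rewrite -(rat_free_extE v) -hp smod_compE.
have [|h [jh hp]] :=
    lift (rat_free_unit A >> underlying_map u) (rat_free_unit B >> underlying_map v).
  apply: sset_map_ext => n x.
  rewrite -[LHS]/(smod_fun (u >> p) n (simplex x)) uv.
  by rewrite smod_compE rat_free_mapE.
exists (rat_free_ext h); split; apply: smod_map_ext => n x.
  by rewrite smod_compE rat_free_mapE rat_free_extE; apply: sset_eqE jh.
by rewrite smod_compE rat_free_extE; apply: sset_eqE hp.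
Qed.

(** The copower of a free simplicial module by I is the free module on I copies of
the simplicial set; as a functor to simplicial sets, it preserves homotopies. *)
Section Copies.
Variable I : Type.

Definition copies (X : sset) : sset.
Proof.
refine (@Simplicial type_cat (fun n => (I * X n)%type)
  (fun m n f x => (x.1, srestr X f x.2)) _ _).
- by move=> n; apply: funext => -[i x]; rewrite srestr1.
- by move=> m n p f g; apply: funext => -[i x]; rewrite srestrM.
Defined.

Definition copy (X : sset) (i : I) : X ~> copies X :=
  @sset_map X (copies X) (fun n x => (i, x)) (fun _ _ _ _ => erefl).

Lemma copair_subproof (X : sset) (Y : smod) (f : I -> rat_free X ~> Y) m n
    (h : mono m n) (x : copies X n) :
  smod_fun (f x.1) m (simplex (srestr X h x.2)) =
  srestr (underlying Y) h (smod_fun (f x.1) n (simplex x.2)).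
Proof. by rewrite -smod_mapP simplex_restr. Qed.

Definition rat_free_copower (X : sset) : copower (C := smod) I (rat_free X).
Proof.
refine (@Copower smod I (rat_free X) (rat_free (copies X))
  (fun i => rat_free_map (copy X i))
  (fun Y f => rat_free_ext (@sset_map (copies X) (underlying Y)
     (fun n x => smod_fun (f x.1) n (simplex x.2)) (copair_subproof f))) _ _).
- move=> Y f i; apply: smod_map_ext => n x.
  by rewrite smod_compE rat_free_mapE rat_free_extE.
- move=> Y f g fg; apply: smod_map_ext => n [i x].
  have /(congr1 (fun h => smod_fun h n (simplex x))) := fg i.
  by rewrite !smod_compE !rat_free_mapE.
Defined.

Definition copies_map (X Y : sset) (f : X ~> Y) :
    rat_free_copower X ~> rat_free_copower Y :=
  cpmap _ _ (rat_free_map f).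

Lemma copies_mapE (X Y : sset) (f : X ~> Y) n i (x : X n) :
  smod_fun (copies_map f) n (@simplex (copies X) n (i, x)) =
  @simplex (copies Y) n (i, f n x).
Proof.
have /(congr1 (fun h => smod_fun h n (simplex x))) :=
  cpmapE (rat_free_copower X) (rat_free_copower Y) (rat_free_map f) i.
by rewrite !smod_compE !rat_free_mapE.
Qed.

Section CopiesHomotopy.
Variables (X Y : sset) (h : sprod X (std_simplex 1) ~> Y).

(** A homotopy extends linearly in its first argument, with the coordinate in the
interval kept as a parameter. *)
Definition copies_htp n (t : mono n 1) :
    {linear smod_deg (rat_free (copies X)) n -> smod_deg (rat_free (copies Y)) n} :=
  mklin (pext_linear (@simplex_respects (copies X) n
    (smod_deg (rat_free (copies Y)) n)
    (fun x => @simplex (copies Y) n (x.1, h n (x.2, t))))).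

Lemma copies_htpE n (t : mono n 1) i (x : X n) :
  copies_htp t (@simplex (copies X) n (i, x)) =
  @simplex (copies Y) n (i, h n (x, t)).
Proof. exact: (pext_gen _ (simplex_respects _)). Qed.

Lemma copies_htp_nat m n (g : mono m n)
    (x : sprod (underlying (rat_free (copies X))) (std_simplex 1) n) :
  copies_htp (mono_comp g x.2) (srestr (underlying (rat_free (copies X))) g x.1) =
  srestr (underlying (rat_free (copies Y))) g (copies_htp x.2 x.1).
Proof.
case: x => w t; set s := mono_comp g t.
apply: (pgen_ext (f := copies_htp s \o
    srestr (rat_free (copies X) : simplicial qmod_cat) g)
  (g := srestr (rat_free (copies Y) : simplicial qmod_cat) g \o copies_htp t)).
move=> -[i x].
set ix := simplex ((i, x) : copies X n).
rewrite -[LHS]/(copies_htp s (srestr (underlying (rat_free (copies X))) g ix)).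
rewrite -[RHS]/(srestr (underlying (rat_free (copies Y))) g (copies_htp t ix)).
rewrite simplex_restr [srestr (copies X) _ _]/= !copies_htpE simplex_restr.
congr simplex; congr pair; exact: (sset_mapP h g (x, t)).
Qed.

End CopiesHomotopy.

Lemma copies_map_elem_homotopic (X Y : sset) (f g : X ~> Y) : elem_homotopic f g ->
  elem_homotopic (underlying_map (copies_map f)) (underlying_map (copies_map g)).
Proof.
case=> h hE.
exists (@sset_map (sprod (underlying (rat_free (copies X))) (std_simplex 1))
  (underlying (rat_free (copies Y))) (fun n x => copies_htp h x.2 x.1)
  (copies_htp_nat h)) => n w.
split.
  apply: (pgen_ext (f := copies_htp h (const_mono n 0))
    (g := smod_fun (copies_map f) n)) => -[i x].
  by rewrite [LHS]copies_htpE [RHS]copies_mapE (hE n x).1.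
apply: (pgen_ext (f := copies_htp h (const_mono n 1))
  (g := smod_fun (copies_map g) n)) => -[i x].
by rewrite [LHS]copies_htpE [RHS]copies_mapE (hE n x).2.
Qed.

Lemma copies_map_homotopic (X Y : sset) (f g : X ~> Y) : homotopic f g ->
  homotopic (underlying_map (copies_map f)) (underlying_map (copies_map g)).
Proof.
elim=> {f g} [f g fg|f|f g _ IH|f g h _ IHf _ IHg].
- by apply/htp_elem/copies_map_elem_homotopic.
- exact: htp_refl.
- exact: htp_sym.
- exact: htp_trans IHg.
Qed.

Lemma copies_map1 (X : sset) :
  underlying_map (copies_map (idm X)) = idm (underlying (rat_free (copies X))).
Proof.
transitivity (underlying_map (idm (rat_free (copies X)))).
  by congr underlying_map; apply: smod_map_ext => n [i x]; rewrite copies_mapE.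
exact: sset_map_ext.
Qed.

Lemma copies_mapM (X Y Z : sset) (f : X ~> Y) (g : Y ~> Z) :
  underlying_map (copies_map (f >> g)) =
  underlying_map (copies_map f) >> underlying_map (copies_map g).
Proof.
transitivity (underlying_map (copies_map f >> copies_map g)); last first.
  exact: sset_map_ext.
congr underlying_map; apply: smod_map_ext => n [i x].
by rewrite smod_compE !copies_mapE.
Qed.

Lemma copies_map_weq (X Y : sset) (f : X ~> Y) :
  homotopy_equiv f -> smod_weq (copies_map f).
Proof.
case=> g [fg gf]; apply: homotopy_equiv_weq; exists (underlying_map (copies_map g)).
by rewrite -!copies_mapM -!copies_map1; split; apply: copies_map_homotopic.
Qed.

End Copies.

(** * The flat and the stable model structures *)

Inductive rat_horn : mclass smod :=
  RatHorn n (k : 'I_n.+2) : rat_horn (rat_free_map (horn_incl k)).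

Lemma rat_horn_lift (X Y : smod) (p : X ~> Y) : rlp rat_horn p <-> smod_fib p.
Proof.
split=> [pJ _ _ _ [n k]|pf _ _ _ [n k]].
  exact/rat_free_lift/pJ.
exact/rat_free_lift/pf.
Qed.

Theorem smod_blended_acyclic_fib (gT : finGroupType) (X Y : gcat gT smod)
    (p : X ~> Y) :
  naive_weq smod_model p /\ blended_fib smod_model p <->
  naive_weq smod_model p /\ naive_fib smod_model p.
Proof.
apply: (blended_acyclic_fib (M := smod_model) (J := rat_horn)
  (simp_averaging qmod_averaging)).
- have um (A B C : smod) (f : A ~> B) (g : B ~> C) :
      underlying_map (f >> g) = underlying_map f >> underlying_map g.
    exact: sset_map_ext.
  have u1 (A : smod) : underlying_map (idm A) = idm _ by exact: sset_map_ext.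
  have ur (A B C D : smod) (f : A ~> B) (g : C ~> D) :
      retract_of f g -> retract_of (underlying_map f) (underlying_map g).
    case=> i [r [j [s [ir js ig rf]]]].
    exists (underlying_map i), (underlying_map r).
    exists (underlying_map j), (underlying_map s).
    by rewrite -!um ir js ig rf !u1.
  by apply: retract_closed_cap => A B C D f g /ur;
    [apply: sset_weq_retract | apply: retract_closed_rlp].
- by move=> A B f /rat_horn_lift.
- by move=> A B j Jj X' Y' q [_ /rat_horn_lift]; apply.
- move=> G A B _ [n k]; exists (rat_free_copower G _), (rat_free_copower G _).
  by apply/copies_map_weq/horn_homotopy_equiv.
Qed.

Theorem corollary4p13 :
  (flat_model rat_circle smod_model smod_gencof =
     stable_model rat_circle smod_model smod_gencof /\
   positive_flat_model rat_circle smod_model smod_gencof =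
     positive_stable_model rat_circle smod_model smod_gencof) /\
  (flat_model rat_shift chain_model chain_gencof =
     stable_model rat_shift chain_model chain_gencof /\
   positive_flat_model rat_shift chain_model chain_gencof =
     positive_stable_model rat_shift chain_model chain_gencof).
Proof.
by split; split; (apply: flat_stable_model || apply: positive_flat_stable_model) => n;
  (apply: smod_blended_acyclic_fib || apply: chain_blended_acyclic_fib).
Qed.
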